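(* Let $(R,\mathfrak m)$ be a Cohen-Macaulay local ring with infinite residue field and dimension $d\ge 1$, and let $I$ be an $\mathfrak m$-primary ideal of $R$ containing a parameter ideal $Q=(x_1,\ldots,x_d)$ as a reduction. If $I$ is an Ulrich ideal of $R$ which is not a parameter ideal, then $\mathrm e^1_I(\Omega^kI)=0$ for all $k\ge d-1$. If in addition $R$ is Gorenstein, then $\mathrm e^1_I(\lambda(\Omega^kI))=0$ for all $k\ge d$.
   Context: All rings are commutative and Noetherian with 1; ''finite'' means finitely generated. A parameter ideal is an ideal generated by a system of parameters. That $Q\subset I$ is a reduction of $I$ means $QI^r=I^{r+1}$ for some $r\ge 0$. The ideal $I$ is Ulrich if $I^2=QI$ and $I/I^2$ is a free $R/I$-module. For a finite $R$-module $M$ with minimal free presentation $F_1\xrightarrow{\partial_1}F_0\to M\to 0$, the Auslander transpose is $\mathrm{Tr}\,M=\mathrm{coker}(\mathrm{Hom}_R(F_0,R)\xrightarrow{\partial_1^*}\mathrm{Hom}_R(F_1,R))$, and the syzygy module is $\Omega M=\mathrm{Im}\,\partial_1\subset F_0$; $\Omega^0M=M$ and $\Omega^kM=\Omega(\Omega^{k-1}M)$ for $k\ge 1$. Set $\lambda M=\Omega\,\mathrm{Tr}\,M$. For a $d$-dimensional finite module $M$, the Hilbert coefficients $\mathrm e^i_I(M)$ are the integers such that $\ell_R(M/I^kM)=\sum_{i=0}^d(-1)^i\mathrm e^i_I(M)\binom{k+d-i-1}{d-i}$ for all $k\gg 0$, where $\ell_R$ denotes length. *)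

(* Defs.v *)
From HB Require Import structures.
From mathcomp Require Import all_boot all_order all_algebra.
From mathcomp Require Import boolp classical_sets functions cardinality.

Set Implicit Arguments.
Unset Strict Implicit.
Unset Printing Implicit Defensive.

Import Order.TTheory GRing.Theory Num.Theory.
Local Open Scope classical_set_scope.
Local Open Scope ring_scope.

(* Subsets of modules and rings are classical sets; an ideal of R is a
   submodule of the regular module R^o. Modules known only up to isomorphism
   (syzygies, transposes) are described by relations: "N is a syzygy of M". *)

Section Modules.
Variable R : comNzRingType.

Definition submodule (V : lmodType R) (S : set V) : Prop :=
  submod_closed (mem S).

(* I N, for I a set of scalars and N a set of vectors *)
Definition smul (V : lmodType R) (I : set R) (N : set V) : set V :=
  [set v | exists n (a : 'I_n -> R) (u : 'I_n -> V),
     [/\ forall i, I (a i), forall i, N (u i) & v = \sum_i a i *: u i]].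

Definition annihilator (V : lmodType R) : set R :=
  [set a | forall v : V, a *: v = 0].

(* The R-module V/N has length l: a composition series of V/N is a maximal
   chain of submodules of V from N to V. *)
Definition quotient_length (V : lmodType R) (N : set V) (l : nat) : Prop :=
  exists L : nat -> set V,
  [/\ L 0%N = N, L l = setT, forall i, (i <= l)%N -> submodule (L i)
    & forall i, (i < l)%N -> L i `<` L i.+1 /\
        forall P : set V, submodule P -> L i `<=` P -> P `<=` L i.+1 ->
          P = L i \/ P = L i.+1].

(* N is isomorphic to the submodule S of V *)
Definition iso_submodule (N V : lmodType R) (S : set V) : Prop :=
  exists2 f : {linear N -> V}, injective f & range f = S.

End Modules.

Section Ideals.
Variable R : comNzRingType.
Implicit Types (I J P Q m : set R) (s : seq R).

Definition ideal I : Prop := submodule (I : set R^o).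

Definition is_proper_ideal I : Prop := ideal I /\ ~ I 1.

Definition prime_ideal P : Prop :=
  is_proper_ideal P /\ prime_idealr_closed (mem P).

Definition maximal_ideal m : Prop :=
  is_proper_ideal m /\ forall J, is_proper_ideal J -> m `<=` J -> J = m.

Definition radical I : set R := [set a | exists n, I (a ^+ n)].

Definition primary_ideal I : Prop :=
  is_proper_ideal I /\ forall a b, I (a * b) -> ~ I a -> radical I b.

Definition primary_to m I : Prop := primary_ideal I /\ radical I = m.

Definition ideal_gen s : set R :=
  [set b | exists a : nat -> R, b = \sum_(i < size s) a i * s`_i].

Definition mul_ideal I J : set R := smul I (J : set R^o).

Fixpoint pow_ideal I (k : nat) : set R :=
  if k is k'.+1 then mul_ideal I (pow_ideal I k') else setT.

Definition noetherian_ring : Prop :=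
  forall I, ideal I -> exists s, I = ideal_gen s.

Definition local_ring m : Prop :=
  maximal_ideal m /\ forall m', maximal_ideal m' -> m' = m.

(* R/m, as a set of cosets *)
Definition residue_classes m : set (set R) :=
  range (fun a : R => [set b | m (b - a)]).

(* P 0 < ... < P n is a chain of primes containing J *)
Definition prime_chain J (n : nat) (P : nat -> set R) : Prop :=
  [/\ J `<=` P 0%N, forall i, (i <= n)%N -> prime_ideal (P i)
    & forall i, (i < n)%N -> P i `<` P i.+1].

(* the Krull dimension of R/J is d *)
Definition quotient_krull_dim J (d : nat) : Prop :=
  (exists P : nat -> set R, prime_chain J d P) /\
  (forall n (P : nat -> set R), prime_chain J n P -> (n <= d)%N).

Definition krull_dim (d : nat) : Prop := quotient_krull_dim [set 0] d.

Definition module_dim (M : lmodType R) (d : nat) : Prop :=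
  quotient_krull_dim (annihilator M) d.

(* each s`_i is a nonzerodivisor on R/(s`_0, ..., s`_(i-1)) *)
Definition regular_sequence s : Prop :=
  (forall i a, (i < size s)%N ->
     ideal_gen (take i s) (a * s`_i) -> ideal_gen (take i s) a)
  /\ ~ ideal_gen s 1.

Definition ring_depth m (n : nat) : Prop :=
  (exists s, [/\ size s = n, forall a, a \in s -> m a & regular_sequence s])
  /\ (forall s, (forall a, a \in s -> m a) -> regular_sequence s ->
        (size s <= n)%N).

Definition cohen_macaulay m : Prop :=
  exists2 d, krull_dim d & ring_depth m d.

Definition system_of_parameters m s : Prop :=
  krull_dim (size s) /\ primary_to m (ideal_gen s).

Definition parameter_ideal m Q : Prop :=
  exists2 s, system_of_parameters m s & Q = ideal_gen s.

Definition reduction Q I : Prop :=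
  Q `<=` I /\
  exists r, mul_ideal Q (pow_ideal I r) = pow_ideal I r.+1.

(* The classes of the y i form a basis of I/I^2 over R/I. Finite bases
   suffice because I is finitely generated. *)
Definition conormal_free I : Prop :=
  exists n (y : 'I_n -> R),
  [/\ forall i, I (y i),
      forall b, I b ->
        exists a : 'I_n -> R, pow_ideal I 2 (b - \sum_i a i * y i)
    & forall a : 'I_n -> R,
        pow_ideal I 2 (\sum_i a i * y i) -> forall i, I (a i)].

Definition ulrich_ideal Q I : Prop :=
  pow_ideal I 2 = mul_ideal Q I /\ conormal_free I.

End Ideals.

Section Homological.
Variable R : comNzRingType.

Definition injective_module (E : lmodType R) : Prop :=
  forall (A B : lmodType R) (f : {linear A -> B}) (g : {linear A -> E}),
    injective f -> exists h : {linear B -> E}, forall a, h (f a) = g a.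

(* Finite injective dimension: M has a finite injective resolution, built one
   short exact sequence 0 -> M -> E -> C -> 0 at a time. *)
Inductive finite_injective_dim : lmodType R -> Prop :=
| finj_injective (M : lmodType R) :
    injective_module M -> finite_injective_dim M
| finj_step (M E C : lmodType R) (f : {linear M -> E}) (g : {linear E -> C}) :
    injective_module E -> injective f ->
    (forall e, g e = 0 <-> range f e) -> range g = setT ->
    finite_injective_dim C -> finite_injective_dim M.

(* meant for a Noetherian local ring R *)
Definition gorenstein_ring : Prop := finite_injective_dim (R^o : lmodType R).

Variable m : set R.

(* F_1 --(u |-> u *m A)--> F_0 --pi--> M --> 0 is exact, and minimal over the
   local ring (R, m): both kernels lie in m F_i. The F_i are free modules of
   row vectors. *)
Definition minimal_presentation (M : lmodType R) (n1 n0 : nat)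
    (A : 'M[R]_(n1, n0)) (pi : {linear 'rV[R]_n0 -> M}) : Prop :=
  [/\ range pi = setT,
      forall v, pi v = 0 <-> exists u : 'rV[R]_n1, v = u *m A,
      forall v, pi v = 0 -> forall j, m (v 0 j)
    & forall u : 'rV[R]_n1, u *m A = 0 -> forall j, m (u 0 j)].

Definition is_syzygy (M N : lmodType R) : Prop :=
  exists n1 n0 (A : 'M[R]_(n1, n0)) (pi : {linear 'rV[R]_n0 -> M}),
    minimal_presentation A pi /\
    iso_submodule N (range (fun u : 'rV[R]_n1 => u *m A)).

Fixpoint is_iter_syzygy (k : nat) (M N : lmodType R) : Prop :=
  if k is k'.+1 then
    exists2 L : lmodType R, is_iter_syzygy k' M L & is_syzygy L N
  else exists f : {linear M -> N}, bijective f.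

(* In the dual bases the dual of u |-> u *m A is v |-> v *m A^T. *)
Definition is_transpose (M T : lmodType R) : Prop :=
  exists n1 n0 (A : 'M[R]_(n1, n0)) (pi : {linear 'rV[R]_n0 -> M}),
    minimal_presentation A pi /\
    exists2 rho : {linear 'rV[R]_n1 -> T}, range rho = setT
      & forall u, rho u = 0 <-> exists v : 'rV[R]_n0, u = v *m A^T.

(* L is lambda M = Omega Tr M *)
Definition is_lambda (M L : lmodType R) : Prop :=
  exists2 T : lmodType R, is_transpose M T & is_syzygy T L.

End Homological.

(* M has a dimension d >= i, the Hilbert coefficients e^0, ..., e^d of M with
   respect to I exist, and e^i = z. *)
Definition hilbert_coefficient (R : comNzRingType) (I : set R)
    (M : lmodType R) (i : nat) (z : int) : Prop :=
  exists d (e : nat -> int),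
  [/\ module_dim M d, (i <= d)%N,
      exists k0, forall k, (k0 <= k)%N ->
        exists2 l, quotient_length (smul (pow_ideal I k) [set: M]) l
          & l%:Z = \sum_(j < d.+1)
                     (-1) ^+ j * e j * ('C(k + d - j - 1, d - j))%:Z
    & e i = z].

(* Main.v *)
(* Put r = mu(I) - d, so that I/Q = (R/I)^r with r > 0. The exact sequence
   0 -> (R/I)^r -> R/Q -> R/I -> 0 presents a free resolution of R/I as the mapping cone of r copies
   of itself into the Koszul complex K of x; the comparison maps can be chosen with entries in I
   because I^2 = QI, so this resolution is minimal. As K vanishes above degree d, every
   N = Omega^k I with k >= d - 1 has a self-similar presentation 0 -> N^r -> R^n -> N -> 0 with
   N^r inside I R^n. By the depth lemma, x is then N-regular, and I N^r lies in
   QI R^n /\ N^r = Q N^r, so I N = Q N. Hence I^k N = Q^k N, and the length of N/I^k N is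
   binom(k + d - 1, d) times that of N/QN: all higher Hilbert coefficients vanish.
   If R is Gorenstein, dimension shifting along the same sequence gives Ext^1(N, R) = 0, so that
   D = N^* sits in a dual presentation 0 -> D -> R^n -> D^r -> 0 with D inside I R^n. The same
   argument applies to D, and lambda N = R^n / D is isomorphic to D^r. *)

Require Import Defs.
From HB Require Import structures.
From mathcomp Require Import all_boot all_order all_algebra.
From mathcomp Require Import perm.
From mathcomp Require Import boolp classical_sets functions cardinality.

Set Implicit Arguments.
Unset Strict Implicit.
Unset Printing Implicit Defensive.

Import Order.TTheory GRing.Theory Num.Theory.
Local Open Scope classical_set_scope.
Local Open Scope ring_scope.

(** * Submodules and spans of sequences *)

(** Cohen-Macaulayness provides some regular sequence y of length d in m, while the argument needs x
    itself to be regular. The passage goes through the Koszul complex K of x: its acyclicity follows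
    from y and from m being the radical of (x), and Nakayama then gives back the regularity of x.
    The isomorphism I/Q = (R/I)^r is not part of the Ulrich condition either: the classes of x have
    to be completed to a basis of I/I^2, by exchange over the local ring R/I. A comparison map has
    entries in I for this reason: it lifts, along the Koszul differential, cycles with entries in
    I^2 = QI, and a chain of positive degree with boundary in QI K has all its entries in I because
    the x_i form a basis of Q/QI over R/I. No homology module, Tor or Ext is formed. Exactness is
    solvability of equations, vanishing of Tor_1 is an equality of submodules, and vanishing of
    Ext^1(N, R) is the extension of maps along N^r -> R^n. *)

Section Submodules.
Variable R : comNzRingType.
Implicit Types V W U : lmodType R.

Lemma submoduleP V (S : set V) :
  submodule S <-> S 0 /\ forall a u v, S u -> S v -> S (a *: u + v).
Proof.
split=> -[S0 SL].
  split; first by move: S0; rewrite in_setE.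
  by move=> a u v Su Sv; move: (SL a u v); rewrite !in_setE; apply.
by split=> [|a u v]; rewrite ?in_setE //; apply: SL.
Qed.

Section Closure.
Variables (V : lmodType R) (S : set V).
Hypothesis subS : submodule S.

Lemma subm0 : S 0. Proof. by case/submoduleP: subS. Qed.

Lemma submL a u v : S u -> S v -> S (a *: u + v).
Proof. by case/submoduleP: subS => _; apply. Qed.

Lemma submZ a u : S u -> S (a *: u).
Proof. by move=> Su; rewrite -[a *: u]addr0; apply: submL => //; apply: subm0. Qed.

Lemma submD u v : S u -> S v -> S (u + v).
Proof. by move=> Su; rewrite -[u]scale1r; apply: submL. Qed.

Lemma submN u : S u -> S (- u).
Proof. by rewrite -scaleN1r; apply: submZ. Qed.

Lemma submB u v : S u -> S v -> S (u - v).
Proof. by move=> Su Sv; apply: submD => //; apply: submN. Qed.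

Lemma submBr u v : S v -> S (u - v) -> S u.
Proof. by move=> Sv Suv; rewrite -(subrK v u); apply: submD. Qed.

Lemma subm_sum (J : Type) (s : seq J) (P : pred J) (F : J -> V) :
  (forall i, P i -> S (F i)) -> S (\sum_(i <- s | P i) F i).
Proof.
by move=> SF; elim/big_rec: _ => [|i v Pi Sv]; [apply: subm0 | apply: submD => //; apply: SF].
Qed.

End Closure.

Lemma submT V : submodule [set: V].
Proof. by apply/submoduleP. Qed.

Lemma subm_zero V : submodule [set (0 : V)].
Proof. by apply/submoduleP; split=> //= a u v -> ->; rewrite scaler0 addr0. Qed.

Lemma subm_ker V W (f : {linear V -> W}) : submodule [set v | f v = 0].
Proof.
apply/submoduleP; split=> [|a u v] /=; first by rewrite linear0.
by rewrite linearP => -> ->; rewrite scaler0 addr0.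
Qed.

Lemma subm_image V W (f : {linear V -> W}) (S : set V) :
  submodule S -> submodule (f @` S).
Proof.
move=> subS; apply/submoduleP; split; first by exists 0; [apply: subm0 | rewrite linear0].
move=> a _ _ [u Su <-] [v Sv <-]; exists (a *: u + v); last by rewrite linearP.
exact: submL.
Qed.

Lemma subm_preimage V W (f : {linear V -> W}) (S : set W) :
  submodule S -> submodule (f @^-1` S).
Proof.
move=> subS; apply/submoduleP; split; first by rewrite /preimage /= linear0; apply: subm0.
by move=> a u v Su Sv; rewrite /preimage /= linearP; apply: submL.
Qed.

Lemma subm_setI V (S T : set V) : submodule S -> submodule T -> submodule (S `&` T).
Proof.
move=> subS subT; apply/submoduleP; split; first by split; apply: subm0.
by move=> a u v [Su Tu] [Sv Tv]; split; apply: submL.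
Qed.

Lemma subm_scale V (a : R) (S : set V) : submodule S -> submodule [set v | S (a *: v)].
Proof.
move=> subS; apply/submoduleP; split=> [|b u v] /=; first by rewrite scaler0; apply: subm0.
by move=> Su Sv; rewrite scalerDr scalerA mulrC -scalerA; apply: submL.
Qed.

Definition addS V (S T : set V) : set V :=
  [set v | exists2 s, S s & exists2 t, T t & v = s + t].

Lemma subm_add V (S T : set V) : submodule S -> submodule T -> submodule (addS S T).
Proof.
move=> subS subT; apply/submoduleP; split.
  by exists 0; [exact: subm0 | exists 0; [exact: subm0 | rewrite addr0]].
move=> a _ _ [s Ss [t Tt ->]] [s' Ss' [t' Tt' ->]]; exists (a *: s + s'); first exact: submL.
by exists (a *: t + t'); [exact: submL | rewrite scalerDr addrACA].
Qed.

Lemma addSl V (S T : set V) : submodule T -> S `<=` addS S T.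
Proof. by move=> subT s Ss; exists s => //; exists 0; [exact: subm0 | rewrite addr0]. Qed.

Lemma addSr V (S T : set V) : submodule S -> T `<=` addS S T.
Proof. by move=> subS s Ss; exists 0; [exact: subm0 | exists s => //; rewrite add0r]. Qed.

Lemma idealM (I : set R) a b : ideal I -> I b -> I (a * b).
Proof. by move=> idI Ib; apply: (submZ idI). Qed.

(** Working with graphs avoids formulas: inverses, factorizations and the map N^r -> R^n of the
    self-similar presentation are obtained from it. By linearity, single-valuedness is tested at 0
    alone. *)
Lemma exists_linear V W (T : set (V * W)%type) :
  submodule T -> (forall v, exists w, T (v, w)) -> (forall w, T (0, w) -> w = 0) ->
  exists f : {linear V -> W}, forall v, T (v, f v).
Proof.
move=> subT tot fun0.
pose f v := projT1 (cid (tot v)).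
have Tf v : T (v, f v) by rewrite /f; case: cid.
have fL : linear f.
  move=> a u v; apply/subr0_eq/fun0.
  have := submB subT (Tf (a *: u + v)) (submL subT a (Tf u) (Tf v)).
  by congr (T _); congr pair => /=; rewrite subrr.
pose F := GRing.isLinear.Build R V W _ f fL.
pose g : {linear V -> W} := HB.pack f F.
by exists g.
Qed.

End Submodules.

Section ListSpan.
Variable R : comNzRingType.
Implicit Types U V W : lmodType R.
Implicit Types s xs : seq R.

(** For a submodule S and a list s generating Q, this is Q S. The recursion on s follows the
    inductions on regular sequences and gives access to one coefficient at a time. *)
Fixpoint lspan V s (S : set V) : set V :=
  if s is x :: s' then
    [set v | exists2 c, S c & exists2 w, lspan s' S w & v = x *: c + w]
  else [set 0].

Lemma subm_lspan V s (S : set V) : submodule S -> submodule (lspan s S).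
Proof.
move=> subS; elim: s => [|x s IHs] /=; first exact: subm_zero.
apply/submoduleP; split.
  by exists 0; [exact: subm0 | exists 0; [exact: subm0 | rewrite scaler0 addr0]].
move=> a _ _ [c Sc [w Sw ->]] [c' Sc' [w' Sw' ->]].
exists (a *: c + c'); first exact: submL.
exists (a *: w + w'); first exact: submL.
by rewrite !scalerDr addrACA !scalerA mulrC.
Qed.

Lemma lspanS V s (S T : set V) : S `<=` T -> lspan s S `<=` lspan s T.
Proof.
move=> ST; elim: s => //= x s IHs _ [c Sc [w Sw ->]].
by exists c; [exact: ST | exists w; [exact: IHs | ]].
Qed.

Lemma lspan_sub V s (S : set V) : submodule S -> lspan s S `<=` S.
Proof.
move=> subS; elim: s => [|x s IHs] /= v; first by move=> ->; exact: subm0.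
by case=> c Sc [w Sw ->]; apply: submL => //; exact: IHs.
Qed.

Lemma lspan_tail V x s (S : set V) : submodule S -> lspan s S `<=` lspan (x :: s) S.
Proof. by move=> subS v Sv; exists 0; [exact: subm0 | exists v => //; rewrite scaler0 add0r]. Qed.

Lemma lspan_mem V s (S : set V) a v : submodule S -> a \in s -> S v -> lspan s S (a *: v).
Proof.
move=> subS; elim: s => // x s IHs; rewrite inE => /orP[/eqP->|/IHs sa] Sv.
  by exists v => //; exists 0; [apply: subm0; exact: subm_lspan | rewrite addr0].
by apply: lspan_tail => //; exact: sa.
Qed.

Lemma lspan_min V s (S T : set V) : submodule T ->
  (forall a v, a \in s -> S v -> T (a *: v)) -> lspan s S `<=` T.
Proof.
move=> subT; elim: s => [|x s IHs] sT v /=; first by move=> ->; exact: subm0.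
case=> c Sc [w Sw ->]; apply: submD => //; first by apply: sT => //; rewrite inE eqxx.
by apply: IHs => // a u sa; apply: sT; rewrite inE sa orbT.
Qed.

Lemma lspan_subseq V s s' (S : set V) : submodule S -> {subset s <= s'} ->
  lspan s S `<=` lspan s' S.
Proof.
move=> subS ss'; apply: lspan_min; first exact: subm_lspan.
by move=> a v /ss' sa Sv; exact: lspan_mem.
Qed.

Lemma lspan_image V W (f : {linear V -> W}) s (S : set V) :
  lspan s (f @` S) = f @` lspan s S.
Proof.
apply/seteqP; split; elim: s => [|x s IHs] w /=.
- by move=> ->; exists 0; rewrite ?linear0.
- case=> _ [c Sc <-] [_ /IHs[u Su <-] ->]; exists (x *: c + u); last by rewrite linearP.
  by exists c => //; exists u.
- by case=> _ -> <-; rewrite linear0.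
- case=> _ [c Sc [u Su ->]] <-; rewrite linearP; exists (f c); first by exists c.
  by exists (f u) => //; apply: IHs; exists u.
Qed.

Lemma lspan_linear V W (f : {linear V -> W}) s (S : set V) (T : set W) v :
  (forall u, S u -> T (f u)) -> lspan s S v -> lspan s T (f v).
Proof.
move=> ST Sv; apply: (@lspanS _ s (f @` S)); first by move=> _ [u Su <-]; exact: ST.
by rewrite lspan_image; exists v.
Qed.

Lemma lspan_sumP V s (S : set V) v : submodule S ->
  lspan s S v <-> exists2 c : nat -> V, forall i, S (c i) & v = \sum_(i < size s) s`_i *: c i.
Proof.
move=> subS; elim: s v => [|x s IHs] v /=.
  split; first by move=> ->; exists (fun=> 0); [move=> _; exact: subm0 | rewrite big_ord0].
  by case=> c _ ->; rewrite big_ord0.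
split=> [[c Sc [w /IHs[c' Sc' ->] ->]]|[c Sc ->]].
  exists (fun i => if i is i'.+1 then c' i' else c); first by case.
  by rewrite big_ord_recl.
rewrite big_ord_recl; exists (c 0%N) => //.
by eexists; last reflexivity; apply/IHs; exists (fun i => c i.+1).
Qed.

Lemma ideal_genE s : ideal_gen s = lspan s [set: R^o].
Proof.
apply/seteqP; split=> b.
  case=> a ->; apply/(lspan_sumP _ _ (@submT _ _)); exists a => //.
  by apply: eq_bigr => i _; rewrite mulrC.
case/(lspan_sumP _ _ (@submT _ _)) => a _ ->; exists a.
by apply: eq_bigr => i _; rewrite mulrC.
Qed.

(* The sequence is read from its end: the head x is regular modulo the tail xs'. *)
Fixpoint rreg V (S : set V) xs : Prop :=
  if xs is x :: xs' then
    (forall v, S v -> lspan xs' S (x *: v) -> lspan xs' S v) /\ rreg S xs'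
  else True.

Lemma lspan_transfer U V W (f : {linear U -> V}) (g : {linear U -> W}) s u :
  (forall u, f u = 0 -> g u = 0) ->
  lspan s (range f) (f u) -> lspan s (range g) (g u).
Proof.
move=> fg; rewrite !lspan_image => -[v sv fvu]; exists v => //.
by apply/subr0_eq; rewrite -linearB; apply: fg; rewrite linearB fvu subrr.
Qed.

(** Equal kernels make the two ranges isomorphic; passing through the common source spares the
    construction of the isomorphism. *)
Lemma rreg_transfer U V W (f : {linear U -> V}) (g : {linear U -> W}) s :
  (forall u, f u = 0 <-> g u = 0) -> rreg (range f) s -> rreg (range g) s.
Proof.
move=> fg; elim: s => //= x s IHs [xreg /IHs reg]; split=> // _ [u _ <-].
have fg' v : f v = 0 -> g v = 0 by move/fg.
have gf v : g v = 0 -> f v = 0 by move/fg.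
rewrite -linearZ => /(lspan_transfer gf); rewrite linearZ => /xreg h.
by apply: (lspan_transfer fg'); apply: h; exists u.
Qed.

(** When s lies in I and generates Q, this is the equality I S = Q S. *)
Definition mul_into V (I : set R) s (S : set V) : Prop :=
  forall a v, I a -> S v -> lspan s S (a *: v).

Lemma mul_into_transfer U V W (f : {linear U -> V}) (g : {linear U -> W}) (I : set R) s :
  (forall u, f u = 0 -> g u = 0) -> mul_into I s (range f) -> mul_into I s (range g).
Proof.
move=> fg fI a _ Ia [u _ <-]; rewrite -linearZ; apply: (lspan_transfer fg).
by rewrite linearZ; apply: fI => //; exists u.
Qed.

(** * The depth lemma for a kernel *)

Section Depth.
Variables (V W : lmodType R) (T : set V) (p : {linear V -> W}).
Hypothesis subT : submodule T.
Let S := [set v | T v /\ p v = 0].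

Lemma subm_kerI : submodule S.
Proof. by apply: subm_setI => //; exact: subm_ker. Qed.

(** An elementary form of Tor_1(R/(s), p(T)) = 0 for s regular on p(T). Regularity makes the image
    of the head coefficient a combination of the tail, so that this coefficient can be corrected
    into the kernel and the error passed on to the tail. *)
Lemma lspan_ker s v : rreg (p @` T) s -> S v -> lspan s T v -> lspan s S v.
Proof.
elim: s v => //= x s IHs v [xreg reg] [Tv pv0] [c Tc [w Tw def_v]].
have sTw := lspan_sub subT Tw.
have : lspan s (p @` T) (x *: p c).
  have -> : x *: p c = p (- w).
    by rewrite linearN -linearZ; apply/subr0_eq; rewrite opprK -linearD -def_v.
  by rewrite lspan_image; exists (- w) => //; apply: submN => //; exact: subm_lspan.
move/xreg; rewrite lspan_image => /(_ (imageP _ Tc))[c' sc' pc'].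
have Tc' := lspan_sub subT sc'.
have Sc : S (c - c') by split; [exact: submB | rewrite linearB pc' subrr].
exists (c - c') => //; exists (x *: c' + w); last by rewrite def_v addrA -scalerDr subrK.
apply: IHs => //; last by apply: submL => //; exact: subm_lspan.
have -> : x *: c' + w = v - x *: (c - c').
  by rewrite def_v scalerBr opprB [x *: c + w]addrC -addrA [x *: c + _]addrC subrK addrC.
by apply: submB => //; [exact: subm_kerI | apply: submZ => //; exact: subm_kerI].
Qed.

Lemma rreg_ker s : rreg T s -> rreg (p @` T) s -> rreg S s.
Proof.
elim: s => //= x s IHs [xT regT] [xU regU]; split; last exact: IHs.
move=> v Sv sxv; apply: lspan_ker => //; apply: xT; first by case: Sv.
by apply: lspanS sxv => u [].
Qed.

(** The gain of one in the depth of a kernel: the step for [x] calls [lspan_ker] along the tail [s]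
    only. *)
Lemma rreg_ker_cons x s : rreg T (x :: s) -> rreg (p @` T) s -> rreg S (x :: s).
Proof.
move=> [xT regT] regU; split; last exact: rreg_ker.
move=> v Sv sxv; apply: lspan_ker => //; apply: xT; first by case: Sv.
by apply: lspanS sxv => u [].
Qed.

End Depth.

End ListSpan.

(** * Finite free modules *)

Section LinearMaps.
Variable R : comNzRingType.
Implicit Types A U V W : lmodType R.

Definition lin_of V W (f : V -> W) (fL : linear f) : {linear V -> W} :=
  HB.pack f (GRing.isLinear.Build R V W _ f fL).

Section Maps.
Variables (V W U : lmodType R) (r : nat).

Lemma inl_linear : linear (fun v : V => (v, 0) : (V * W)%type).
Proof. by move=> a u v; congr pair; rewrite /= scaler0 addr0. Qed.
Definition inl_lin := lin_of inl_linear.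

Lemma inr_linear : linear (fun w : W => (0, w) : (V * W)%type).
Proof. by move=> a u v; congr pair; rewrite /= scaler0 addr0. Qed.
Definition inr_lin := lin_of inr_linear.

Lemma fst_linear : linear (fun p : V * W => p.1). Proof. by []. Qed.
Definition fst_lin := lin_of fst_linear.

Lemma snd_linear : linear (fun p : V * W => p.2). Proof. by []. Qed.
Definition snd_lin := lin_of snd_linear.

Lemma ev_linear (i : 'I_r) : linear (fun w : {ffun 'I_r -> V} => w i).
Proof. by move=> a u v; rewrite !ffunE. Qed.
Definition ev_lin i := lin_of (ev_linear i).

Lemma in_linear (i : 'I_r) :
  linear (fun v : V => [ffun j => if j == i then v else 0] : {ffun 'I_r -> V}).
Proof.
by move=> a u v; apply/ffunP=> j; rewrite !ffunE; case: eqP; rewrite // scaler0 addr0.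
Qed.
Definition in_lin i := lin_of (in_linear i).

Lemma const_linear : linear (fun v : V => [ffun=> v] : {ffun 'I_r -> V}).
Proof. by move=> a u v; apply/ffunP=> j; rewrite !ffunE. Qed.
Definition const_lin := lin_of const_linear.

Lemma map_linear (f : {linear V -> W}) :
  linear (fun w : {ffun 'I_r -> V} => [ffun i => f (w i)] : {ffun 'I_r -> W}).
Proof. by move=> a u v; apply/ffunP=> j; rewrite !ffunE linearP. Qed.
Definition map_lin f := lin_of (map_linear f).

Lemma scale_linear (a : R) : linear (fun v : V => a *: v).
Proof. by move=> b u v; rewrite scalerDr !scalerA mulrC. Qed.
Definition scale_lin a := lin_of (scale_linear a).

Lemma point_linear (v : V) : linear (fun a : R^o => a *: v).
Proof. by move=> b u w; rewrite scalerDl scalerA. Qed.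
Definition point_lin v := lin_of (point_linear v).

Lemma combine_linear n (w : 'I_n -> W) :
  linear (fun u : 'rV[R]_n => \sum_i u 0 i *: w i).
Proof.
move=> a u v; rewrite scaler_sumr -big_split; apply: eq_bigr => i _.
by rewrite /= !mxE scalerDl scalerA.
Qed.
Definition combine_lin n w := lin_of (@combine_linear n w).

Lemma id_linear : linear (fun v : V => v). Proof. by []. Qed.
Definition id_lin := lin_of id_linear.

Lemma ffun_sum_in (w : {ffun 'I_r -> V}) : w = \sum_i in_lin i (w i).
Proof.
apply/ffunP=> j; rewrite sum_ffunE (bigD1 j) //= ffunE eqxx big1 ?addr0 // => i.
by rewrite ffunE eq_sym; case: eqP.
Qed.

End Maps.

Lemma inverse_linear V W (f : {linear V -> W}) : bijective f ->
  exists2 g : {linear W -> V}, cancel f g & cancel g f.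
Proof.
move=> bij_f; have [h fK hK] := bij_f.
have [|w|v /=|g gP] := @exists_linear R W V [set p | f p.2 = p.1].
- apply/submoduleP; split=> [|a u v] /=; first by rewrite linear0.
  by rewrite linearP => -> ->.
- by exists (h w); rewrite /= hK.
- by move=> fv0; apply: (bij_inj bij_f); rewrite linear0.
exists g => [v|w]; last exact: gP.
by apply: (bij_inj bij_f); exact: gP.
Qed.

Lemma subm_eq V W A (f : {linear V -> A}) (g : {linear W -> A}) :
  submodule [set x : (W * V)%type | f x.2 = g x.1].
Proof.
apply/submoduleP; split=> [|a u v eu ev].
  by have e0 : f 0 = g 0 by [rewrite !linear0]; exact: e0.
have eP : f (a *: u.2 + v.2) = g (a *: u.1 + v.1) by rewrite !linearP eu ev.
exact: eP.
Qed.

Lemma factor_inj V W A (f : {linear V -> A}) (g : {linear W -> A}) :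
  injective f -> (forall w, range f (g w)) -> exists h : {linear W -> V}, forall w, f (h w) = g w.
Proof.
move=> injf fg; have [|v|h hP] := exists_linear (subm_eq f g); last by exists h.
  by move=> w; have [v _ ev] := fg w; exists v.
by rewrite /= linear0 => e0; apply: injf; rewrite e0 linear0.
Qed.

Lemma factor_surj V W A (p : {linear V -> A}) (g : {linear V -> W}) :
  range p = setT -> (forall v, p v = 0 -> g v = 0) ->
  exists h : {linear A -> W}, forall v, h (p v) = g v.
Proof.
move=> surp pg.
have [|a|w|h hP] := @exists_linear R A W (range (fun v => (p v, g v))).
- apply/submoduleP; split; first by exists 0; rewrite // !linear0.
  by move=> a _ _ [u _ <-] [v _ <-]; exists (a *: u + v); rewrite // !linearP.
- by have : range p a; [rewrite surp | case=> v _ <-; exists (g v), v].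
- by case=> v _ [/pg gv0 <-].
by exists h => v; have [v' _ [ev <-]] := hP (p v); apply/subr0_eq;
  rewrite -linearB; apply: pg; rewrite linearB ev subrr.
Qed.

Definition ffree V : Prop := exists n, exists f : {linear 'rV[R]_n -> V}, bijective f.

Lemma ffree_rV n : ffree 'rV[R]_n.
Proof. by exists n, (id_lin _), id. Qed.

Lemma ffree_regular : ffree (R^o : lmodType R).
Proof.
exists 1%N, (@combine_lin (R^o : lmodType R) 1 (fun=> 1 : R)), (fun a : R => a%:M).
  by move=> u; apply/rowP=> i; rewrite /= big_ord1 !ord1 !mxE eqxx mulr1n [_ *: _]mulr1.
by move=> a; rewrite /= big_ord1 mxE eqxx mulr1n [_ *: _]mulr1.
Qed.

Lemma ffree_pair V W : ffree V -> ffree W -> ffree (V * W)%type.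
Proof.
move=> [n [f [f' fK f'K]]] [p [g [g' gK g'K]]].
have hL : linear (fun u : 'rV[R]_(n + p) => (f (lsubmx u), g (rsubmx u)) : (V * W)%type).
  by move=> a u v; congr pair; rewrite /= !linearP.
exists (n + p)%N, (lin_of hL), (fun q => row_mx (f' q.1) (g' q.2)).
  by move=> u; rewrite /= fK gK hsubmxK.
by move=> [v w]; rewrite /= row_mxKl row_mxKr f'K g'K.
Qed.

Lemma ffree_ffun V r : ffree V -> ffree {ffun 'I_r -> V}.
Proof.
move=> [n [f [f' fK f'K]]].
have hL : linear (fun u : 'rV[R]_(r * n) =>
    [ffun i => f (row i (vec_mx u))] : {ffun 'I_r -> V}).
  by move=> a u v; apply/ffunP=> i; rewrite !ffunE !linearP.
exists (r * n)%N, (lin_of hL), (fun w : {ffun 'I_r -> V} => mxvec (\matrix_i f' (w i))).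
  move=> u; rewrite -[RHS]vec_mxK; congr mxvec; apply/row_matrixP=> i.
  by rewrite rowK ffunE fK.
by move=> w; apply/ffunP=> i; rewrite /= ffunE mxvecK rowK f'K.
Qed.

(** Projectivity stated for relations: values are chosen on a basis, and T contains the rest of the
    graph because it is a submodule. *)
Lemma lift_free V W (T : set (V * W)%type) : ffree V ->
  submodule T -> (forall v, exists w, T (v, w)) ->
  exists f : {linear V -> W}, forall v, T (v, f v).
Proof.
move=> [n [f bij_f]] subT tot; have [g fK gK] := inverse_linear bij_f.
have [w Tw] := choice (fun i : 'I_n => tot (f (delta_mx 0 i))).
exists (combine_lin w \o g : {linear V -> W}) => v /=.
have -> : (v, \sum_i g v 0 i *: w i) = \sum_i g v 0 i *: ((f (delta_mx 0 i), w i) : (V * W)%type).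
  apply: injective_projections.
    rewrite /= -{1}[v]gK {1}[g v]row_sum_delta linear_sum (linear_sum (fst_lin V W)).
    by apply: eq_bigr => i _; rewrite linearZ.
  by rewrite (linear_sum (snd_lin V W)).
by apply: subm_sum => // i _; apply: submZ.
Qed.

End LinearMaps.

Section Extension.
Variable R : comNzRingType.
Implicit Types (U V W : lmodType R) (I J : set R).

Lemma smul_mem V I (N : set V) a v : I a -> N v -> smul I N (a *: v).
Proof. by move=> Ia Nv; exists 1%N, (fun=> a), (fun=> v); split; rewrite ?big_ord1. Qed.

Lemma smul_min V I (N T : set V) : submodule T ->
  (forall a v, I a -> N v -> T (a *: v)) -> smul I N `<=` T.
Proof.
move=> subT INT _ [n [a [u [Ia Nu ->]]]]; apply: subm_sum => // i _; exact: INT.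
Qed.

Lemma subm_smul V I (N : set V) : submodule N -> submodule (smul I N).
Proof.
move=> subN; apply/submoduleP; split.
  by exists 0%N, (fun=> 0), (fun=> 0); split; rewrite ?big_ord0 //; case.
move=> b _ _ [n [a [u [Ia Nu ->]]]] [p [a' [u' [Ia' Nu' ->]]]].
exists (n + p)%N,
  (fun i : 'I_(n + p) => match fintype.split i with inl j => a j | inr j => a' j end),
  (fun i : 'I_(n + p) => match fintype.split i with inl j => b *: u j | inr j => u' j end).
split; first by move=> i; case: fintype.split.
  by move=> i; case: fintype.split => // j; apply: submZ.
rewrite big_split_ord scaler_sumr; congr (_ + _); apply: eq_bigr => i _.
  by rewrite (unsplitK (inl i : 'I_n + 'I_p)) !scalerA mulrC.
by rewrite (unsplitK (inr i : 'I_n + 'I_p)).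
Qed.

Lemma smulS V I J (N N' : set V) : I `<=` J -> N `<=` N' -> smul I N `<=` smul J N'.
Proof.
move=> IJ NN' _ [n [a [u [Ia Nu ->]]]]; exists n, a, u; split=> // i; [exact: IJ | exact: NN'].
Qed.

Lemma smul_linear V W I (N : set V) (N' : set W) (f : {linear V -> W}) v :
  (forall u, N u -> N' (f u)) -> smul I N v -> smul I N' (f v).
Proof.
move=> NN' [n [a [u [Ia Nu ->]]]]; exists n, a, (fun i => f (u i)); split=> // [i|].
  exact: NN'.
by rewrite linear_sum; apply: eq_bigr => i _; rewrite linearZ.
Qed.

(* I V: the extension of the ideal I to the module V (not the functor Ext) *)
Definition ext V I : set V := smul I [set: V].
Arguments ext : clear implicits.

Lemma subm_ext V I : submodule (ext V I).
Proof. by apply: subm_smul; exact: submT. Qed.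
Hint Resolve subm_ext : core.

Lemma ext_mem V I a (v : V) : I a -> ext V I (a *: v).
Proof. by move=> Ia; apply: smul_mem. Qed.

Lemma ext_linear V W I (f : {linear V -> W}) v : ext V I v -> ext W I (f v).
Proof. exact: smul_linear. Qed.

Lemma ext_regular I : ideal I -> ext (R^o : lmodType R) I = I.
Proof.
move=> idI; apply/seteqP; split.
  by apply: smul_min => // a v Ia _; rewrite /= [_ *: _]mulrC; exact: idealM.
by move=> a Ia; rewrite -[a]mulr1; apply: (@ext_mem (R^o : lmodType R)).
Qed.

Lemma ext_pair V W I (p : (V * W)%type) : ext V I p.1 -> ext W I p.2 -> ext (V * W)%type I p.
Proof.
move=> Ip1 Ip2.
have -> : p = inl_lin V W p.1 + inr_lin V W p.2.
  by case: p {Ip1 Ip2} => v w; congr pair; rewrite /= ?addr0 ?add0r.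
by apply: submD; [exact: subm_ext | exact: ext_linear | exact: ext_linear].
Qed.

Lemma ext_fst V W I (p : (V * W)%type) : ext (V * W)%type I p -> ext V I p.1.
Proof. exact: (@ext_linear _ _ _ (fst_lin V W)). Qed.

Lemma ext_snd V W I (p : (V * W)%type) : ext (V * W)%type I p -> ext W I p.2.
Proof. exact: (@ext_linear _ _ _ (snd_lin V W)). Qed.

Lemma ext_ffun V r I (w : {ffun 'I_r -> V}) :
  (forall i, ext V I (w i)) -> ext {ffun 'I_r -> V} I w.
Proof.
move=> Iw; rewrite (ffun_sum_in w); apply: subm_sum => [|i _]; first exact: subm_ext.
exact: ext_linear.
Qed.

Lemma ext_rV n I (v : 'rV[R]_n) : ideal I -> ext 'rV[R]_n I v <-> forall j, I (v 0 j).
Proof.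
move=> idI; split=> [|Iv].
  apply: (@smul_min _ _ _ [set v : 'rV[R]_n | forall j, I (v 0 j)]) => [|a u Ia _ j].
    apply/submoduleP; split=> [j|a u w Iu Iw j]; first by rewrite mxE; exact: (subm0 idI).
    by rewrite !mxE; apply: (submL idI); [exact: Iu | exact: Iw].
  by rewrite mxE mulrC; exact: idealM.
rewrite [v]row_sum_delta; apply: subm_sum => [|j _]; first exact: subm_ext.
by apply: ext_mem; exact: Iv.
Qed.

Lemma lspan_ext V I s : {in s, forall a, I a} -> ideal I ->
  lspan s [set: V] `<=` ext V I.
Proof.
move=> sI idI; apply: lspan_min; first exact: subm_ext.
by move=> a v /sI Ia _; exact: ext_mem.
Qed.

Lemma mul_ext V I s a v :
  (forall a b, I a -> I b -> lspan s (I : set R^o) (a * b)) ->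
  I a -> ext V I v -> lspan s (ext V I) (a *: v).
Proof.
move=> sI Ia; apply: (smul_min (subm_scale a (subm_lspan s (subm_ext V I)))) => b u Ib _ /=.
rewrite scalerA; apply: (@lspan_linear _ _ _ (point_lin u) _ I); last exact: sI.
by move=> c Ic; exact: ext_mem.
Qed.

(** Since f has entries in I, it carries I V into I^2 W, which [sI] moves into Q I W. In this form
    I^2 = QI acts on the comparison maps. *)
Lemma mul_ext_linear V W I s (f : {linear V -> W}) v :
  (forall a b, I a -> I b -> lspan s (I : set R^o) (a * b)) ->
  (forall u, ext W I (f u)) -> ext V I v -> lspan s (ext W I) (f v).
Proof.
move=> sI fI.
apply: (smul_min (subm_preimage f (subm_lspan s (subm_ext W I)))) => a u Ia _.
by rewrite /preimage /= linearZ; apply: mul_ext.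
Qed.

End Extension.
Arguments ext {R} V I.
#[export] Hint Resolve subm_ext : core.

(** * The Koszul complex *)

Section Koszul.
Variable R : comNzRingType.
Implicit Types (V W : lmodType R) (I J : set R) (xs ys : seq R).

(* The Koszul complex of x :: xs is the cone of multiplication by x on that of xs. *)
Fixpoint koszul xs (k : nat) : lmodType R :=
  match xs with
  | [::] => match k with 0 => R^o | _ => 'rV[R]_0 end
  | x :: xs' =>
      match k with 0 => koszul xs' 0 | k'.+1 => (koszul xs' k'.+1 * koszul xs' k')%type end
  end.

Fixpoint koszul_d xs k : koszul xs k.+1 -> koszul xs k :=
  match xs with
  | [::] => fun=> 0
  | x :: xs' => match k with
     | 0 => fun p => koszul_d p.1 + x *: p.2
     | k'.+1 => fun p => (koszul_d p.1 + x *: p.2, - koszul_d p.2)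
     end
  end.

Fixpoint koszul0 xs : koszul xs 0 -> R^o :=
  match xs with [::] => fun a => a | x :: xs' => @koszul0 xs' end.

Lemma koszul_ind (P : lmodType R -> Prop) :
  P R^o -> P 'rV[R]_0 -> (forall V W, P V -> P W -> P (V * W)%type) ->
  forall xs k, P (koszul xs k).
Proof.
move=> PR P0 Ppair; elim=> [|x xs IHxs] [|k] /=;
  [exact: PR | exact: P0 | exact: IHxs | exact: Ppair].
Qed.

Lemma ffree_koszul xs k : ffree (koszul xs k).
Proof.
apply: koszul_ind; [exact: ffree_regular | exact: ffree_rV | exact: ffree_pair].
Qed.

Lemma koszul_d_linear xs k : linear (@koszul_d xs k).
Proof.
elim: xs k => [|x xs IHxs] [|k] a u v //=; rewrite ?scaler0 ?addr0 //.
  by rewrite IHxs scalerDr scalerDr !scalerA [x * a]mulrC addrACA.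
congr pair; rewrite /= IHxs ?scalerN ?opprD //.
by rewrite !scalerDr !scalerA [x * a]mulrC addrACA.
Qed.

HB.instance Definition _ xs k :=
  GRing.isLinear.Build R (koszul xs k.+1) (koszul xs k) _ (@koszul_d xs k) (@koszul_d_linear xs k).

Lemma koszul0_linear xs : linear (@koszul0 xs). Proof. by elim: xs. Qed.

HB.instance Definition _ xs :=
  GRing.isLinear.Build R (koszul xs 0) R^o _ (@koszul0 xs) (@koszul0_linear xs).

Lemma koszul0_bij xs : bijective (@koszul0 xs). Proof. by elim: xs => //=; exists id. Qed.

Lemma koszul_dK xs k (u : koszul xs k.+2) : koszul_d (koszul_d u) = 0.
Proof.
elim: xs k u => [|x xs IHxs] [|k] //= [a b] /=.
  by rewrite linearD /= IHxs linearZ add0r scalerN subrr.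
by rewrite linearD /= IHxs linearZ add0r scalerN subrr -[- koszul_d b]scaleN1r
  linearZ /= IHxs scaler0 oppr0.
Qed.

Lemma koszul_zero xs k (u : koszul xs k) : (size xs < k)%N -> u = 0.
Proof.
elim: xs k u => [|x xs IHxs] [|k] //= u; first by move=> _; exact: thinmx0.
by case: u => a b /= lek; congr pair; apply: IHxs => //; exact: ltnW.
Qed.

Lemma lspan_koszul_d0 xs (u : koszul xs 1) : lspan xs [set: R^o] (koszul0 (koszul_d u)).
Proof.
elim: xs u => [|x xs IHxs] /= u //.
by rewrite addrC linearD linearZ; exists (koszul0 u.2) => //; exists (koszul0 (koszul_d u.1)).
Qed.

Lemma lspan_koszul_d0_lift xs I a : ideal I -> lspan xs (I : set R^o) a ->
  exists2 u : koszul xs 1, ext _ I u & koszul0 (koszul_d u) = a.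
Proof.
move=> idI; elim: xs a => [|x xs IHxs] a /=.
  by move=> ->; exists 0 => //; apply: subm0.
case=> c Ic [_ /IHxs[u Iu <-] ->]; have [g gK kgK] := inverse_linear (koszul0_bij xs).
exists (u, g c); last by rewrite /= linearD linearZ kgK addrC.
have Ic' : ext (R^o : lmodType R) I c by rewrite ext_regular.
apply: ext_pair => /=; first exact: Iu.
exact: (ext_linear g Ic').
Qed.

Lemma koszul_d_ext xs I k (u : koszul xs k.+1) : ideal I -> {in xs, forall a, I a} ->
  ext _ I (koszul_d u).
Proof.
move=> idI; elim: xs k u => [|x xs IHxs] [|k] u xsI /=.
- exact: subm0.
- exact: subm0.
- apply: submD => //; first by apply: IHxs => a xsa; apply: xsI; rewrite inE xsa orbT.
  by apply: ext_mem; apply: xsI; rewrite inE eqxx.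
have {}IHxs k' (v : koszul xs k'.+1) : ext _ I (koszul_d v).
  by apply: IHxs => a xsa; apply: xsI; rewrite inE xsa orbT.
apply: ext_pair; last by apply: submN.
by apply: submD => //; apply: ext_mem; apply: xsI; rewrite inE eqxx.
Qed.

(** Elements of (xs) kill Koszul homology. For z = x c + w, the homotopy on the cone is that of w on
    both summands, with opposite sign on the second, plus multiplication by c from the first summand
    to the second. *)
Lemma koszul_homotopy xs z : lspan xs [set: R^o] z ->
  exists h : forall k, koszul xs k -> koszul xs k.+1,
  [/\ forall k, linear (h k), forall u, koszul_d (h 0%N u) = z *: u
    & forall k u, koszul_d (h k.+1 u) + h k (koszul_d u) = z *: u].
Proof.
elim: xs z => [|x xs IHxs] z /=.
  move=> ->; exists (fun k _ => 0); split=> [k a u v|u|k u]; rewrite ?scaler0 ?scale0r ?addr0 //.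
case=> c _ [w /IHxs[h [hL h0 hS]] ->].
exists (fun k => match k return koszul (x :: xs) k -> koszul (x :: xs) k.+1 with
   | 0 => fun a => (h 0%N a, c *: a)
   | k'.+1 => fun p => (h k'.+1 p.1, c *: p.1 - h k' p.2)
   end); split=> [[|k] a u v|u|[|k] [u v]] /=.
- by rewrite hL; congr pair; rewrite /= scalerDr !scalerA mulrC.
- by rewrite !hL; congr pair; rewrite /= scalerDr scalerBr opprD !scalerA [a * c]mulrC addrACA.
- by rewrite h0 scalerA scalerDl addrC.
- have hD k a b c' : h k (a + c' *: b) = h k a + c' *: h k b by rewrite addrC hL addrC.
  rewrite hD; congr pair => /=.
    by rewrite addrACA hS -scalerDr subrK scalerA addrC -scalerDl.
  rewrite linearB linearZ /= h0 opprB scalerDr addrA subrK scalerDl scalerA.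
  by rewrite [c * x]mulrC addrC.
- have hD k' a b c' : h k' (a + c' *: b) = h k' a + c' *: h k' b by rewrite addrC hL addrC.
  have hN k' a : h k' (- a) = - h k' a.
    have h00 : h k' 0 = 0 by move: (hL k' (-1) 0 0); rewrite scaler0 addr0 scaleN1r addNr.
    by have := hL k' (-1) a 0; rewrite h00 !addr0 !scaleN1r.
  rewrite hD hN; congr pair => /=.
    by rewrite addrACA hS -scalerDr subrK scalerA addrC -scalerDl.
  rewrite scalerDl -(hS _ v) linearB linearZ /= opprB opprK scalerDr.
  by rewrite -[_ + _ + h k _]addrA [LHS]addrA subrK scalerA [c * x]mulrC addrCA.
Qed.

End Koszul.

(** * Acyclicity of the Koszul complex, and its differential modulo I *)

Section Acyclicity.
Variable R : comNzRingType.
Implicit Types (V W : lmodType R) (I J : set R) (xs ys zs : seq R).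

Section Acyclic.
Variables (xs ys : seq R).
Let J t : set R := lspan (take t ys) [set: R^o].
Hypothesis size_xy : (size xs <= size ys)%N.
Hypothesis y_reg : forall t (a : R), (t < size ys)%N -> J t (a * ys`_t) -> J t a.
Hypothesis y_rad : forall y, y \in ys -> exists n, lspan xs [set: R^o] (y ^+ n).

Let idJ t : ideal (J t). Proof. by apply: subm_lspan; exact: submT. Qed.

Lemma ext_koszul_reg t k (z : koszul xs k) : (t < size ys)%N ->
  ext _ (J t) (ys`_t *: z) -> ext _ (J t) z.
Proof.
move=> lt_t; move: z.
apply: (@koszul_ind R (fun V => forall v : V, ext V (J t) (ys`_t *: v) -> ext V (J t) v))
  => [v|v _|V W regV regW p Jp].
- by rewrite ext_regular // => Jv; apply: y_reg => //; rewrite mulrC.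
- by rewrite [v]thinmx0; exact: subm0.
apply: ext_pair; first by apply: regV; exact: (ext_fst Jp).
by apply: regW; exact: (ext_snd Jp).
Qed.

Lemma ext_take_rcons t V (v : V) : (t < size ys)%N ->
  ext V (J t.+1) v -> exists e, ext V (J t) (v - ys`_t *: e).
Proof.
move=> lt_t; move: v.
suff : ext V (J t.+1) `<=` [set v | exists e, ext V (J t) (v - ys`_t *: e)] by [].
apply: smul_min.
  apply/submoduleP; split=> [|a u w [e Ju] [e' Jw]].
    by exists 0; rewrite scaler0 subrr; exact: subm0.
  exists (a *: e + e'); rewrite scalerDr opprD addrACA scalerA mulrC -scalerA -scalerBr.
  exact: submL.
move=> a u Ja _; move: Ja; rewrite /J (take_nth 0) // -cats1.
rewrite -ideal_genE => -[c ->].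
exists (c (size (take t ys)) *: u); rewrite size_cat big_split_ord /= big_ord_recl big_ord0 addr0.
rewrite addn0 nth_cat ltnn subnn /= scalerDl !scalerA [c _ * _]mulrC addrK.
apply: ext_mem; rewrite -ideal_genE; exists c; apply: eq_bigr => i _.
by rewrite nth_cat ltn_ord.
Qed.

(* H_i(x; R/J_t) = 0 for i > t, by descending induction on t: y_t acts injectively on this homology
   by the induction hypothesis, and nilpotently because y_t is in the radical of (x). *)
Lemma koszul_exact_mod n t k (z : koszul xs k.+1) : (t + n)%N = size xs -> (t <= k)%N ->
  ext _ (J t) (koszul_d z) -> exists w, ext _ (J t) (z - koszul_d w).
Proof.
elim: n t k z => [|n IHn] t k z.
  rewrite addn0 => -> ltk _; exists 0; rewrite [z]koszul_zero // linear0 subrr.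
  exact: subm0.
move=> def_t le_tk Jz; have lt_t : (t < size ys)%N.
  by apply: leq_trans size_xy; rewrite -def_t -addSnnS leq_addr.
(* If d f = y_t z' modulo J_t, then f is a cycle modulo J_(t+1), one degree higher, so f = d w + y_t
   e modulo J_t by induction. Cancelling y_t shows that e bounds z'. *)
have step z' : ext _ (J t) (koszul_d z') ->
    (exists w, ext _ (J t) (ys`_t *: z' - koszul_d w)) ->
    exists w, ext (koszul xs k.+1) (J t) (z' - koszul_d w).
  move=> Jz' [f Jf].
  have subJ : J t `<=` J t.+1.
    apply: (@lspan_subseq R (R^o : lmodType R)); first exact: submT.
    by move=> a at_; rewrite (take_nth 0) // mem_rcons inE at_ orbT.
  have Jf1 : ext _ (J t.+1) (koszul_d f).
    rewrite -[koszul_d f](subrK (ys`_t *: z')) -opprB; apply: submD => //.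
      by apply: submN => //; apply: smulS Jf.
    apply: ext_mem; rewrite /J (take_nth 0) // -[X in lspan _ _ X]mulr1.
    apply: (@lspan_mem R (R^o : lmodType R)) => //; first exact: submT.
    by rewrite mem_rcons inE eqxx.
  have def_t1 : (t.+1 + n)%N = size xs by rewrite addSnnS.
  have [w Jw] := IHn _ k.+1 f def_t1 le_tk Jf1.
  have [e Je] := ext_take_rcons lt_t Jw.
  exists e; apply: ext_koszul_reg => //.
  rewrite scalerBr -(subrK (koszul_d f) (ys`_t *: z')) -addrA; apply: submD => //.
  have -> : koszul_d f - ys`_t *: koszul_d e = koszul_d (f - koszul_d w - ys`_t *: e).
    by rewrite [RHS]linearB /= [koszul_d (f - _)]linearB /= koszul_dK subr0
      [koszul_d (_ *: e)]linearZ.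
  exact: ext_linear Je.
have [m xm] : exists m, lspan xs [set: R^o] (ys`_t ^+ m) by apply: y_rad; rewrite mem_nth.
have {xm} [h [hL _ hS]] := koszul_homotopy xm.
have : exists w, ext _ (J t) (ys`_t ^+ m *: z - koszul_d w).
  exists (h _ z); rewrite -hS addrAC subrr add0r.
  exact: (ext_linear (lin_of (hL k)) Jz).
elim: m {hS} z Jz => [|m IHm] z Jz; first by rewrite expr0 scale1r.
rewrite exprSr -scalerA => Jm; apply: step => //; apply: IHm => //.
by rewrite linearZ; apply: submZ.
Qed.

Lemma koszul_exact k (z : koszul xs k.+1) : koszul_d z = 0 -> exists w, koszul_d w = z.
Proof.
move=> z0; have [|w] := @koszul_exact_mod (size xs) 0 k z (add0n _) (leq0n _).
  by rewrite z0; exact: subm0.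
rewrite /J take0 => zw; exists w; apply/esym/subr0_eq.
apply: (smul_min (@subm_zero _ _) _ zw) => a v /= -> _; exact: scale0r.
Qed.

End Acyclic.

Section Independent.
Variables (I : set R) (zs : seq R).
Hypothesis idI : ideal I.
Hypothesis indep : forall c : nat -> R,
  lspan zs (I : set R^o) (\sum_(i < size zs) zs`_i * c i) -> forall i, (i < size zs)%N -> I (c i).

(** With Q generated by zs, the differential modulo QI is the map from Lambda^(k+1) to Lambda^k
    tensored with Q/QI over R/I; it is injective because zs is a basis of Q/QI. The prefix ys makes
    the induction work: peeling the head x off xs turns the second component of the cone into the
    coefficient of x, which joins the b's. *)
Lemma koszul_d_ext_inv_gen xs ys k (a : koszul xs k.+1) (b : nat -> koszul xs k) : ys ++ xs = zs ->
  lspan zs (ext _ I) (koszul_d a + \sum_(i < size ys) ys`_i *: b i) ->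
  ext _ I a /\ forall i, (i < size ys)%N -> ext _ I (b i).
Proof.
have sum_rcons V x (ys' : seq R) (c : nat -> V) (d : V) :
    \sum_(i < size (rcons ys' x)) (rcons ys' x)`_i *: (if (i < size ys')%N then c i else d) =
    \sum_(i < size ys') ys'`_i *: c i + x *: d.
  rewrite size_rcons big_ord_recr /= nth_rcons !ltnn eqxx; congr (_ + _).
  by apply: eq_bigr => i _; rewrite nth_rcons ltn_ord.
elim: xs ys k a b => [|x xs IHxs] ys k a b; rewrite ?cats0 => def_zs.
  rewrite def_zs => Ib; split.
    by rewrite [a](@koszul_zero _ [::]) //; exact: subm0.
  case: k a b Ib => [|k] a b; last by move=> _ i _; rewrite [b i]thinmx0; exact: subm0.
  rewrite add0r /= ext_regular // => Ib; exact: indep.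
rewrite -cat_rcons in def_zs.
case: k a b => [|k] a b /= Iab.
  have [|Ia1 Ib] := IHxs _ _ a.1 (fun i => if (i < size ys)%N then b i else a.2) def_zs.
    by rewrite sum_rcons addrA addrAC.
  split=> [|i lti]; last by have := Ib i; rewrite size_rcons lti; apply; exact: ltnW.
  by apply: ext_pair => //; have := Ib (size ys); rewrite size_rcons ltnn; apply.
have [] := IHxs _ _ a.1 (fun i => if (i < size ys)%N then (b i).1 else a.2) def_zs.
  move: (lspan_linear (f := fst_lin (koszul xs k.+1) (koszul xs k)) (@ext_fst _ _ _ I) Iab).
  by rewrite linearD linear_sum /= (sum_rcons _ x ys (fun i => (b i).1)) addrA addrAC.
move=> Ia1 Ib1.
have [] := IHxs _ _ (- a.2) (fun i => if (i < size ys)%N then (b i).2 else 0) def_zs.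
  move: (lspan_linear (f := snd_lin (koszul xs k.+1) (koszul xs k)) (@ext_snd _ _ _ I) Iab).
  by rewrite linearD linear_sum /= (sum_rcons _ x ys (fun i => (b i).2)) scaler0 addr0 linearN.
move=> Ia2 Ib2; split.
  by apply: ext_pair => //; rewrite -[a.2]opprK; apply: submN.
move=> i lti; have lti' : (i < size (rcons ys x))%N by rewrite size_rcons ltnS ltnW.
by have := Ib1 i lti'; have := Ib2 i lti'; rewrite lti => Ib2i Ib1i; apply: ext_pair.
Qed.

Lemma koszul_d_ext_inv k (a : koszul zs k.+1) : lspan zs (ext _ I) (koszul_d a) -> ext _ I a.
Proof.
move=> Ia; have [] // := @koszul_d_ext_inv_gen zs [::] k a (fun=> 0) erefl.
by rewrite big_ord0 addr0.
Qed.

End Independent.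

End Acyclicity.

(** * Noetherian local rings *)

Section Noetherian.
Variable R : comNzRingType.
Implicit Types (V W : lmodType R) (I J : set R) (xs zs : seq R).
Hypothesis noethR : noetherian_ring R.

Lemma ideal_max (F : set (set R)) J0 : F `<=` @ideal R -> F J0 ->
  exists2 M, F M & forall J, F J -> M `<=` J -> J = M.
Proof.
move=> Fid FJ0; apply: contrapT => noM.
have next M : exists J, F M -> [/\ F J, M `<=` J & ~ J `<=` M].
  have [FM|] := pselect (F M); last by exists M.
  apply: contrapT => noJ; apply: noM; exists M => // J FJ MJ.
  apply/seteqP; split=> //; apply: contrapT => JM; apply: noJ; exists J => _; split=> //.
have [g gP] := choice next.
pose J n := iter n g J0.
have FJ n : F (J n) by elim: n => //= n IHn; have [] := gP _ IHn.
have Jmono n p : (n <= p)%N -> J n `<=` J p.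
  move=> /subnK <-; elim: (p - n)%N => //= q IHq; apply: subset_trans IHq _.
  by have [] := gP _ (FJ (q + n)%N).
pose U := \bigcup_n J n.
have idU : ideal U.
  apply/submoduleP; split; first by exists 0%N => //; apply: subm0; exact: Fid.
  move=> a u v [n _ Ju] [p _ Jv]; exists (maxn n p) => //; apply: submL; first exact: Fid.
    by apply: Jmono Ju; exact: leq_maxl.
  by apply: Jmono Jv; exact: leq_maxr.
have [s def_U] := noethR idU.
have [n Un] : exists n, U `<=` J n.
  rewrite {1}def_U ideal_genE.
  have : {in s, forall a, U a}.
    move=> a sa; rewrite def_U ideal_genE -[a]mulr1.
    by apply: (@lspan_mem R (R^o : lmodType R)) => //; exact: submT.
  elim: (s) => [|a s' IHs] Us.
    by exists 0%N => b /= ->; apply: subm0; exact: Fid.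
  have [n1 _ Ja] : U a by apply: Us; rewrite inE eqxx.
  have [|n2 Js] := IHs; first by move=> b sb; apply: Us; rewrite inE sb orbT.
  exists (maxn n1 n2) => _ [c _ [w /Js Jw ->]]; apply: submD; first exact: Fid.
    rewrite [_ *: _]mulrC; apply: idealM; first exact: Fid.
    by apply: Jmono Ja; exact: leq_maxl.
  by apply: Jmono Jw; exact: leq_maxr.
have [_ _ []] := gP _ (FJ n).
by apply: subset_trans Un => a Ja; exists n.+1.
Qed.

Definition fgen V (S : set V) : Prop :=
  exists n (g : 'I_n -> V), (forall i, S (g i)) /\
    forall v, S v -> exists a : 'I_n -> R, v = \sum_i a i *: g i.

Definition noeth V : Prop := forall S : set V, submodule S -> fgen S.

Lemma noeth_regular : noeth (R^o : lmodType R).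
Proof.
move=> S idS; have [s def_S] := noethR idS.
exists (size s), (fun i => s`_i); split=> [i|v].
  rewrite def_S ideal_genE -[s`_i]mulr1.
  by apply: (@lspan_mem R (R^o : lmodType R)); [exact: submT | exact: mem_nth | ].
by rewrite def_S => -[a ->]; exists (fun i => a i).
Qed.

Lemma noeth_pair V W : noeth V -> noeth W -> noeth (V * W)%type.
Proof.
move=> nV nW S subS.
have [n [g [Sg genS]]] := nV _ (subm_preimage (inl_lin V W) subS).
have [p [h [Sh genT]]] := nW _ (subm_image (snd_lin V W) subS).
have /choice[q qP] j : exists x : (V * W)%type, S x /\ x.2 = h j.
  by have [x Sx xh] := Sh j; exists x.
exists (n + p)%N, (fun i : 'I_(n + p) =>
  match fintype.split i with inl j => (g j, 0) | inr j => q j end).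
split=> [i|v Sv]; first by case: fintype.split => j; [exact: Sg | case: (qP j)].
have [b def_v2] := genT v.2 (imageP (snd_lin V W) Sv).
have v1 : (v - \sum_j b j *: q j).2 = 0.
  apply/eqP; rewrite subr_eq0 def_v2 (linear_sum (snd_lin V W)); apply/eqP/eq_bigr => j _.
  by rewrite linearZ /= (proj2 (qP j)).
have : S (v - \sum_j b j *: q j).
  by apply: submB => //; apply: subm_sum => // j _; apply: submZ => //; case: (qP j).
move def_u: (v - _) v1 => u v1 Su; have [|a def_v1] := genS u.1.
  by rewrite /preimage /= -v1 -surjective_pairing.
exists (fun i : 'I_(n + p) => match fintype.split i with inl j => a j | inr j => b j end).
rewrite big_split_ord /= -[v](subrK (\sum_j b j *: q j)) def_u; congr (_ + _).
  rewrite [LHS]surjective_pairing v1 def_v1 -[LHS]/(inl_lin V W _) linear_sum.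
  by apply: eq_bigr => i _; rewrite (unsplitK (inl i : 'I_n + 'I_p)) linearZ.
by apply: eq_bigr => i _; rewrite (unsplitK (inr i : 'I_n + 'I_p)).
Qed.

Lemma noeth_koszul xs k : noeth (koszul xs k).
Proof.
apply: (@koszul_ind R (@noeth)); [exact: noeth_regular | | exact: noeth_pair].
move=> S _; exists 0%N, (fun=> 0); split=> [[]|v _] //.
by exists (fun=> 0); rewrite [v]thinmx0 big_ord0.
Qed.

End Noetherian.

Section Local.
Variables (R : comNzRingType) (m : set R).
Implicit Types (V W : lmodType R) (I J : set R) (xs zs : seq R).
Hypotheses (noethR : noetherian_ring R) (localR : local_ring m).

Lemma local_ideal : ideal m. Proof. by case: localR => [[[]]]. Qed.

Lemma local_unit a : ~ m a -> exists b, a * b = 1.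
Proof.
move=> ma; apply: contrapT => no_b; apply: ma.
have [_ m_uniq] := localR.
pose J := lspan [:: a] [set: R^o].
have idJ : ideal J by apply: subm_lspan; exact: submT.
have Ja : J a by exists 1 => //; exists 0; rewrite //= [_ *: _]mulr1 addr0.
have [||M [[idM M1] JM] maxM] :=
  @ideal_max R noethR [set M | is_proper_ideal M /\ J `<=` M] J.
- by move=> M [[]].
- split=> //; split=> // -[b _ [_ /= -> ab]]; apply: no_b; exists b.
  by rewrite ab addr0.
have <- : M = m; last exact: JM.
apply: m_uniq; split=> // J' [idJ' J'1] MJ'; apply: maxM => //=; split=> //.
exact: subset_trans MJ'.
Qed.

Lemma local_not1 a : m (a - 1) -> ~ m a.
Proof.
have [[[idm m1] _] _] := localR => ma1 ma; apply: m1.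
by rewrite -[1](subKr a); apply: (submB idm).
Qed.

Lemma det_mod J n (A B : 'M[R]_n) : ideal J ->
  (forall i j, J (A i j - B i j)) -> J (\det A - \det B).
Proof.
move=> idJ AB; rewrite /determinant -sumrB; apply: (subm_sum idJ) => s _.
rewrite -mulrBr; apply: idealM => //.
elim/big_rec2: _ => [|i a b _ Jab]; first by rewrite subrr; exact: (subm0 idJ).
have -> : A i (s i) * b - B i (s i) * a = A i (s i) * (b - a) + a * (A i (s i) - B i (s i)).
  by rewrite !mulrBr [a * A _ _]mulrC [a * B _ _]mulrC addrA subrK.
by apply: (submD idJ); apply: idealM.
Qed.

Lemma det_unit n (A : 'M[R]_n) : (forall i j, m (A i j - 1%:M i j)) ->
  exists b, \det A * b = 1.
Proof.
move=> Am; apply/local_unit/local_not1; rewrite -(det1 _ n).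
by apply: det_mod => //; exact: local_ideal.
Qed.

(** The matrix 1 - x C carries the generators of Z into B, and its determinant is 1 modulo m. A
    single x in m suffices because the Koszul complex grows by one element at a time. *)
Lemma nakayama V (Z B : set V) x : fgen Z -> submodule B -> m x ->
  (forall z, Z z -> exists b z', [/\ B b, Z z' & z = b + x *: z']) -> Z `<=` B.
Proof.
move=> [n [g [Zg genZ]]] subB mx ZB.
have /choice[C CP] i : exists c : 'I_n -> R, B (g i - x *: \sum_j c j *: g j).
  have [b [z [Bb /genZ[c ->] ->]]] := ZB _ (Zg i).
  by exists c; rewrite addrK.
pose D : 'M[R]_n := \matrix_(i, j) ((i == j)%:R - x * C i j).
have [|b Db] := @det_unit _ D.
  move=> i j; rewrite !mxE addrAC subrr add0r; apply: (submN local_ideal).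
  by rewrite mulrC; apply: (idealM _ local_ideal).
suff Bg i : B (g i).
  by move=> _ /genZ[a ->]; apply: subm_sum => // i _; apply: submZ.
have Dg j : B (\sum_k D j k *: g k).
  have -> : \sum_k D j k *: g k = g j - x *: \sum_k C j k *: g k.
    rewrite scaler_sumr (eq_bigr (fun k => (j == k)%:R *: g k - x *: (C j k *: g k))).
      rewrite sumrB; congr (_ - _).
      rewrite (bigD1 j) //= eqxx scale1r big1 ?addr0 // => k.
      by rewrite eq_sym => /negPf ->; rewrite scale0r.
    by move=> k _; rewrite !mxE scalerBl scalerA.
  exact: CP.
have -> : g i = b *: \sum_j (\adj D) i j *: \sum_k D j k *: g k.
  have -> : \sum_j (\adj D) i j *: \sum_k D j k *: g k = \det D *: g i.
    under eq_bigr => j _ do rewrite scaler_sumr.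
    rewrite exchange_big (eq_bigr (fun k => (\adj D *m D) i k *: g k)) /=.
      rewrite mul_adj_mx (bigD1 i) //= mxE eqxx mulr1n big1 ?addr0 // => k.
      by rewrite mxE eq_sym => /negPf ->; rewrite scale0r.
    by move=> k _; rewrite mxE scaler_suml; apply: eq_bigr => j _; rewrite scalerA.
  by rewrite scalerA mulrC Db scale1r.
by apply: submZ => //; apply: subm_sum => // j _; apply: submZ.
Qed.

(** In the long exact sequence of the cone, H_1 = 0 for x :: xs makes x injective on H_0 and
    surjective on H_1 of xs. Nakayama then gives H_1 = 0 for xs, and the induction goes on. *)
Lemma rreg_of_exact xs : (forall a, a \in xs -> m a) ->
  (forall z : koszul xs 1, koszul_d z = 0 -> exists w, koszul_d w = z) -> rreg [set: R^o] xs.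
Proof.
elim: xs => //= x xs IHxs xm exact_x; split.
  move=> v _ /(lspan_koszul_d0_lift (@submT R (R^o : lmodType R)))[u _ def_xv].
  have [g gK kgK] := inverse_linear (koszul0_bij xs).
  have [|[w1 w2] [_ w2v]] := exact_x (- u, g v).
    apply: (bij_inj (koszul0_bij xs)); rewrite /= linear0 linearD linearZ linearN /=.
    by rewrite linearN /= def_xv kgK addNr.
  rewrite -[v]kgK -w2v -[- koszul_d w2](linearN (koszul_d (k := 0))); exact: lspan_koszul_d0.
apply: IHxs => [a xa|z z0]; first by apply: xm; rewrite inE xa orbT.
have subB : submodule (range (@koszul_d R xs 1)) by apply: subm_image; exact: submT.
suff ZB : [set u : koszul xs 1 | koszul_d u = 0] `<=` range (@koszul_d R xs 1).
  by have [w _ wz] := ZB z z0; exists w.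
apply: (@nakayama _ _ _ x _ subB) => [||u u0]; last 1 first.
- have [|[w1 w2] [w1u w20]] := exact_x (u, 0); first by rewrite /= u0 scaler0 addr0.
  exists (koszul_d w1), w2; split=> //=; first by exists w1.
  by apply/eqP; rewrite -oppr_eq0 w20.
- by apply: noeth_koszul => //; exact: (subm_ker (@koszul_d R xs 0)).
- by apply: xm; rewrite inE eqxx.
Qed.

End Local.

(** * Bases of I/I^2 *)

Section Relations.
Variable R : comNzRingType.
Implicit Types (V W : lmodType R) (I J : set R) (xs ys zs : seq R).

(** Regularity writes the head coefficient as a combination of xs with coefficients e_i;
    substituting it leaves a relation on xs with coefficients c_(i+1) + x e_i. *)
Lemma rreg_relation xs (c : nat -> R) : rreg [set: R^o] xs ->
  \sum_(i < size xs) xs`_i * c i = 0 ->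
  forall i, (i < size xs)%N -> lspan xs [set: R^o] (c i).
Proof.
have subT := @submT R (R^o : lmodType R).
elim: xs c => [|x xs IHxs] c /=; first by move=> _ _ [].
case=> xreg reg; rewrite big_ord_recl /= => sum0.
have : lspan xs [set: R^o] (x *: (c 0%N : R^o)).
  apply/(lspan_sumP _ _ subT); exists (fun i => - c i.+1) => //.
  have/eqP := sum0; rewrite addr_eq0 -[_ *: _]/(x * c 0%N) => /eqP ->; rewrite -sumrN.
  by apply: eq_bigr => i _; rewrite -mulrN.
move/(xreg _ I) => xc0; have [e _ def_c0] := proj1 (lspan_sumP _ _ subT) xc0.
have rel : \sum_(i < size xs) xs`_i * (c i.+1 + x * e i) = 0.
  rewrite -[RHS]sum0 addrC def_c0 mulr_sumr -big_split; apply: eq_bigr => i _.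
  by rewrite mulrDr; congr (_ + _); rewrite mulrCA.
case=> [_|i lti]; first exact: lspan_tail.
have xs_ci := IHxs (fun i => c i.+1 + x * e i) reg rel i lti.
exists (- e i) => //; exists (c i.+1 + x * e i) => //.
by rewrite scalerN addrC addrK.
Qed.

(** Two expressions of one element differ by a relation, whose coefficients lie in (xs), hence in I.
    So xs is a basis of Q/QI over R/I. *)
Lemma rreg_independent I xs : ideal I -> {in xs, forall a, I a} -> rreg [set: R^o] xs ->
  forall c : nat -> R, lspan xs (I : set R^o) (\sum_(i < size xs) xs`_i * c i) ->
  forall i, (i < size xs)%N -> I (c i).
Proof.
move=> idI xsI reg c /(lspan_sumP _ _ idI)[q Iq eq_cq] i lti.
apply: (submBr idI (Iq i)).
have xsQ : lspan xs [set: R^o] (c i - q i).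
  apply: (@rreg_relation xs (fun i => c i - q i)) => //.
  by under eq_bigr => j _ do rewrite mulrBr; rewrite sumrB eq_cq subrr.
by have := lspan_ext xsI idI xsQ; rewrite ext_regular.
Qed.

Lemma lspan_cat V s s' (S : set V) : submodule S ->
  lspan (s ++ s') S = addS (lspan s S) (lspan s' S).
Proof.
move=> subS; have sub_s s0 := subm_lspan s0 subS.
apply/seteqP; split.
  apply: lspan_min; first exact: subm_add.
  move=> a v; rewrite mem_cat => /orP[sa|sa] Sv.
    by apply: addSl; [exact: sub_s | exact: lspan_mem].
  by apply: addSr; [exact: sub_s | exact: lspan_mem].
move=> _ [u su [w sw ->]]; apply: submD => //.
  by apply: lspan_subseq su => // a sa; rewrite mem_cat sa.
by apply: lspan_subseq sw => // a sa; rewrite mem_cat sa orbT.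
Qed.

End Relations.

Lemma perm_cons2 (T : eqType) (x w : T) s u :
  perm_eq s (w :: u) -> perm_eq (x :: s) (w :: x :: u).
Proof.
by move=> p; rewrite perm_sym -[w :: _]/([:: w] ++ [:: x] ++ u) perm_catCA /= perm_cons perm_sym.
Qed.

Section Rest.
Variables (T : eqType) (x0 : T) (s : seq T) (i : nat).
Hypothesis lti : (i < size s)%N.

Lemma perm_rest : perm_eq s (nth x0 s i :: (take i s ++ drop i.+1 s)).
Proof.
rewrite -{1}(cat_take_drop i s) (drop_nth x0 lti) perm_sym -cat1s.
by rewrite perm_catCA cat1s.
Qed.

Lemma mem_restP b : reflect (exists j, [/\ (j < size s)%N, j != i & b = nth x0 s j])
  (b \in take i s ++ drop i.+1 s).
Proof.
rewrite mem_cat; apply: (iffP orP) => [[]|[j [ltj ji ->]]].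
- move/(nthP x0)=> [j ltj <-]; rewrite size_take lti in ltj; exists j.
  by rewrite nth_take // (ltn_trans ltj lti) neq_ltn ltj.
- move/(nthP x0)=> [j ltj <-]; rewrite size_drop ltn_subRL in ltj; exists (i.+1 + j)%N.
  by rewrite nth_drop neq_ltn orbC addSn ltnS leq_addr.
move: ji; rewrite neq_ltn => /orP[ltji|ltij]; [left|right].
  by rewrite -(nth_take x0 ltji) mem_nth // size_take lti.
rewrite -(subnKC ltij) -nth_drop mem_nth // size_drop.
by rewrite ltn_sub2r // (leq_ltn_trans ltij ltj).
Qed.

End Rest.

Lemma addr_subB (V : zmodType) (c u w : V) : c = u + (c - w - (u - w)).
Proof. by rewrite opprB addrCA [u + _]addrC !subrK. Qed.

(** * Exchange in I/I^2 over the local ring R/I *)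

Section Exchange.
Variables (R : comNzRingType) (m I : set R).
Hypotheses (noethR : noetherian_ring R) (localR : local_ring m).
Hypothesis I_primary : primary_to m I.
Let T := pow_ideal I 2.
Let mod2 (s : seq R) : set R := addS (lspan s [set: R^o]) (T : set R^o).

Lemma primary_to_ideal : ideal I. Proof. by case: I_primary => [[[]]]. Qed.
Let idI := primary_to_ideal.

(** Take c with (J : c) maximal among the colon ideals of elements outside J. If c a^(p+1) is
    outside J, its colon ideal contains (J : c), hence equals it, and c a^(p+2) in J puts a into it.
    The class of c is thus a nonzero socle element of R/J. *)
Lemma socle_mod J : ideal J -> ~ J 1 -> (forall a, m a -> exists n, J (a ^+ n)) ->
  exists2 c, ~ J c & forall a, m a -> J (c * a).
Proof.
move=> idJ J1 radJ; pose colon a := [set b | J (a * b)].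
have [_ [c Jc ->] maxJ] : exists2 M, (exists2 a, ~ J a & M = colon a) &
    forall M', (exists2 a, ~ J a & M' = colon a) -> M `<=` M' -> M' = M.
  apply: (@ideal_max R noethR [set M | exists2 a, ~ J a & M = colon a] (colon 1)).
    move=> _ [a _ ->]; exact: (subm_preimage (scale_lin (R^o : lmodType R) a) idJ).
  by exists 1.
exists c => // a /radJ[n].
suff step p : J (c * a ^+ p.+1) -> J (c * a).
  by move=> Jan; apply: (step n); rewrite exprSr mulrCA mulrC; exact: idealM.
elim: p => [|p IHp] Jap; first by rewrite expr1 in Jap.
have [/IHp //|nJap] := pselect (J (c * a ^+ p.+1)).
rewrite -[J _]/(colon c a) -(maxJ (colon (c * a ^+ p.+1))); first last.
- by move=> b Jcb; rewrite /colon /= -mulrA mulrCA; apply: idealM.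
- by exists (c * a ^+ p.+1).
by rewrite /colon /= -mulrA -exprSr.
Qed.

Lemma socle_element : exists2 c, ~ I c & forall a, m a -> I (c * a).
Proof.
have [[[_ I1] _] radI] := I_primary.
by apply: socle_mod => // a; rewrite -radI.
Qed.

Lemma mem_pow2 a b : I a -> I b -> T (a * b).
Proof.
move=> Ia Ib; rewrite -[b]mulr1 -[a * _]/((a : R) *: (b * 1 : R^o)) /T /=.
apply: smul_mem => //; apply: (@smul_mem _ (R^o : lmodType R)) => //.
Qed.

Lemma idT : ideal T.
Proof. by do 2!apply: subm_smul => //; exact: submT. Qed.

Lemma subm_mod2 s : ideal (mod2 s).
Proof. by apply: subm_add; [apply: subm_lspan; exact: submT | exact: idT]. Qed.

Lemma mod2_subset s s' : {subset s <= s'} -> mod2 s `<=` mod2 s'.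
Proof.
move=> ss' _ [u su [t Tt ->]]; exists u; last by exists t.
by apply: lspan_subseq su => //; exact: submT.
Qed.

(* s is a basis of I / I^2 over R / I; stating independence through perm_eq makes it invariant
   under reordering s *)
Definition conormal_basis (s : seq R) : Prop :=
  [/\ {in s, forall a, I a}, I `<=` mod2 s
    & forall v s', perm_eq s (v :: s') -> forall c, mod2 s' (c * v) -> I c].

Lemma conormal_basis_perm s s' : perm_eq s s' -> conormal_basis s -> conormal_basis s'.
Proof.
move=> ss' [sI Is indep]; split=> [a s'a|a /Is|v s'' s's''].
  by apply: sI; rewrite (perm_mem ss').
  by apply: mod2_subset => b; rewrite (perm_mem ss').
by apply: indep; apply: perm_trans s's''.
Qed.

Lemma conormal_free_basis : conormal_free I -> exists s, conormal_basis s.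
Proof.
move=> [n [y [Iy gen indep]]]; exists [seq y i | i <- enum 'I_n].
have span_sum (a : 'I_n -> R) (P : pred 'I_n) (s : seq R) :
    (forall i, P i -> y i \in s) -> lspan s [set: R^o] (\sum_(i | P i) a i * y i).
  move=> Ps; apply: (@subm_sum R (R^o : lmodType R)) => [|i Pi].
    by apply: subm_lspan; exact: submT.
  by rewrite mulrC; apply: (@lspan_mem R (R^o : lmodType R)) => //; [exact: submT | exact: Ps].
split=> [_ /mapP[i _ ->]|b Ib|v s' ps'] //.
  have [a Ta] := gen b Ib; exists (\sum_i a i * y i); last
    by eexists; [exact: Ta | rewrite addrC subrK].
  by apply: span_sum => i _; apply/mapP; exists i; rewrite ?mem_enum.
have /mapP[i _ def_v] : v \in [seq y i | i <- enum 'I_n] by rewrite (perm_mem ps') inE eqxx.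
have s'P b : b \in s' -> exists2 j, j != i & b = y j.
  have pr := perm_to_rem (mem_enum 'I_n i).
  have : perm_eq (y i :: s') (y i :: [seq y j | j <- rem i (enum 'I_n)]).
    rewrite -def_v perm_sym in ps' *; apply: perm_trans ps' _.
    by rewrite def_v; exact: (perm_map y pr).
  rewrite perm_cons => /perm_mem -> /mapP[j].
  rewrite mem_rem_uniq ?enum_uniq // inE => /andP[ji _] ->.
  by exists j.
move=> c [w sw [t Tt def_cv]].
have [a ai0 def_w] : exists2 a : 'I_n -> R, a i = 0 & w = \sum_j a j * y j.
  apply: (@lspan_min R (R^o : lmodType R) s' setT
    [set w | exists2 a : 'I_n -> R, a i = 0 & w = \sum_j a j * y j] _ _ w sw).
    apply/submoduleP; split; first by exists (fun=> 0); rewrite // big1 // => j _; rewrite mul0r.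
    move=> e _ _ [a ai0 ->] [a' ai0' ->]; exists (fun j => e * a j + a' j).
      by rewrite ai0 ai0' mulr0 addr0.
    rewrite [_ *: _]mulr_sumr -big_split; apply: eq_bigr => j _.
    by rewrite mulrDl mulrA.
  move=> b e /s'P[j ji ->] _; exists (fun k => if k == j then e else 0).
    by rewrite eq_sym (negPf ji).
  rewrite (bigD1 j) //= eqxx big1 ?addr0 ?[_ *: _]mulrC // => k /negPf ->.
  by rewrite mul0r.
have : T (\sum_j (if j == i then c else - a j) * y j).
  rewrite (bigD1 i) //= eqxx -def_v def_cv def_w (bigD1 i) //= ai0 mul0r add0r.
  rewrite addrC addrA -big_split big1 ?add0r // => j /negPf -> /=.
  by rewrite mulNr addNr.
by move/indep/(_ i); rewrite eqxx.
Qed.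

Lemma lspan_unit_coef s (w : R^o) : lspan s [set: R^o] w ->
  lspan s (m : set R^o) w \/
  exists v s' a, [/\ perm_eq s (v :: s'), ~ m a & lspan s' [set: R^o] (w - a * v)].
Proof.
elim: s w => [|v s IHs] w /=; first by left.
case=> c _ [w' sw' ->].
have [mc|mc] := pselect (m c); last first.
  right; exists v, s, c; split=> //.
  by rewrite [c * v]mulrC addrC addrA addNr add0r.
have [mw'|[u [s' [a [ps ma sa]]]]] := IHs w' sw'.
  by left; exists c => //; exists w'.
right; exists u, (v :: s'), a; split=> //; last first.
  by exists c => //; exists (w' - a * u); rewrite // addrA.
exact: perm_cons2.
Qed.

Lemma mod2_cons v s c w : mod2 s w -> mod2 (v :: s) (c * v + w).
Proof.
move=> sw; apply: (submD (subm_mod2 _)); last by apply: mod2_subset sw => a sa; rewrite inE sa orbT.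
apply: addSl; first exact: idT.
by rewrite mulrC; apply: (@lspan_mem R (R^o : lmodType R)); [exact: submT | rewrite inE eqxx | ].
Qed.

Lemma mod2_consP v s w : mod2 (v :: s) w -> exists c, mod2 s (w - c * v).
Proof.
case=> _ [c _ [u su ->]] [t Tt ->]; exists c, u => //; exists t => //.
by rewrite -[v *: c]/(v * c) mulrC -[_ + u + t]addrA [LHS]addrC addKr.
Qed.

(** Steinitz exchange: the coefficient a of v in x is a unit, so v is recovered from x. To test
    independence at an element other than x, the coefficient of x is first shown to be in I, after
    which its term vanishes modulo I^2. *)
Lemma conormal_exchange s s' v x a : perm_eq s (v :: s') -> conormal_basis s ->
  I x -> ~ m a -> mod2 s' (x - a * v) -> conormal_basis (x :: s').
Proof.
move=> ps /(conormal_basis_perm ps) [sI Is indep] Ix /(local_unit noethR localR)[b ab] sx.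
have I_unit c : I (c * a) -> I c.
  by move=> Ica; rewrite -[c]mulr1 -ab mulrA mulrC; apply: idealM.
have s'x c : mod2 s' (c * x) -> mod2 s' (c * a * v).
  move=> scx; rewrite -[c * a * v](subKr (c * x)).
  apply: (submB (subm_mod2 _)) => //; rewrite -mulrA -mulrBr.
  by apply: (idealM _ (subm_mod2 _)).
split=> [c|c /Is /mod2_consP[e sc]|w s'' pxs].
- by rewrite inE => /orP[/eqP-> //|s'c]; apply: sI; rewrite inE s'c orbT.
- have -> : c = e * b * x + (c - e * v - e * b * (x - a * v)).
    have -> : e * b * (x - a * v) = e * b * x - e * v.
      by rewrite mulrBr [e * b * (a * v)]mulrA -[e * b * a]mulrA [b * a]mulrC ab mulr1.
    exact: addr_subB.
  apply: mod2_cons; apply: (submB (subm_mod2 _)) => //.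
  by apply: (idealM _ (subm_mod2 _)).
have := perm_mem pxs x; rewrite !inE eqxx /= => /esym/orP[/eqP xw|xs''] c.
  move: pxs; rewrite -xw perm_cons => ps' sc; apply: I_unit.
  apply: (indep v s') => //; apply: s'x; apply: mod2_subset sc => d.
  by rewrite (perm_mem ps').
have ps'' := perm_to_rem xs''; set u := rem x s'' in ps''.
have pwu : perm_eq s' (w :: u).
  by rewrite -(perm_cons x); apply: perm_trans pxs _; exact: perm_cons2.
move=> sc; have {sc} : mod2 (x :: u) (c * w) by apply: mod2_subset sc => d; rewrite (perm_mem ps'').
case/mod2_consP=> e uce.
have Ie : I e.
  apply: I_unit; apply: (indep v s') => //; apply: s'x.
  have -> : e * x = c * w + - (c * w - e * x) by rewrite opprB addrC subrK.
  apply: mod2_subset (mod2_cons w c (submN (subm_mod2 _) uce)) => d.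
  by rewrite (perm_mem pwu).
apply: (indep w (v :: u)); first exact: perm_cons2.
have -> : c * w = 0 * v + (e * x + (c * w - e * x)) by rewrite mul0r add0r addrC subrK.
apply: mod2_cons; apply: (submD (subm_mod2 _)) => //.
by apply: addSr; [apply: subm_lspan; exact: submT | exact: mem_pow2].
Qed.

Lemma conormal_basis_complete xs : conormal_free I -> {in xs, forall a, I a} ->
  (forall v s', perm_eq xs (v :: s') -> forall c, mod2 s' (c * v) -> I c) ->
  exists ys, conormal_basis (ys ++ xs).
Proof.
move=> /conormal_free_basis[s0 bas0].
elim: xs => [|x xs IHxs] xsI indep; first by exists s0; rewrite cats0.
have [|v s' ps c sc|ys bas] := IHxs.
- by move=> a xa; apply: xsI; rewrite inE xa orbT.
- apply: (indep v (x :: s')); last by rewrite -[c * v]add0r -[0](mul0r x); exact: mod2_cons.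
  exact: perm_cons2.
have Ix : I x by apply: xsI; rewrite inE eqxx.
have [sI Is _] := bas.
have := Is x Ix; rewrite /mod2 lspan_cat; last exact: submT.
case=> _ [u yu [w xw ->]] [t Tt def_x].
have [mu|[v [s' [a [ps ma s'u]]]]] := lspan_unit_coef yu; last first.
  exists s'; apply: (@conormal_basis_perm (x :: (s' ++ xs))).
    by rewrite perm_sym -[x :: xs]cat1s perm_catCA.
  apply: (@conormal_exchange (ys ++ xs) _ v x a) => //.
    by rewrite -cat_cons perm_cat2r.
  exists (u - a * v + w); last first.
    by exists t => //; rewrite def_x -!addrA; congr (_ + _); rewrite addrA addrC.
  rewrite lspan_cat; last exact: submT.
  by exists (u - a * v) => //; exists w.
(* Here all coefficients of x on ys lie in m. A socle element c of R/I sends them into I, so c x is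
   in the span of xs modulo I^2, against independence. *)
exfalso; have [c Ic cm] := socle_element; apply: Ic.
apply: (indep x xs (perm_refl _)).
have -> : c * x = c * w + c * (u + t) by rewrite def_x -mulrDr addrCA addrA.
exists (c * w); first by apply: (@submZ _ _ _ (subm_lspan _ (@submT R (R^o : lmodType R))) c).
exists (c * (u + t)) => //; rewrite mulrDr; apply: (submD idT); last by apply: (idealM _ idT).
apply: (@lspan_min R (R^o : lmodType R) ys m [set u | T (c * u)] _ _ u mu).
  exact: (subm_preimage (scale_lin (R^o : lmodType R) c) idT).
move=> b e yb me; rewrite /= -[b *: e]/(b * e) mulrCA mulrC; apply: mem_pow2; first exact: cm.
by apply: sI; rewrite mem_cat yb.
Qed.

(** As I^2 lies in QI, a relation on xs modulo I^2 is one modulo QI, and regularity makes its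
    coefficients lie in I. The elements that complete xs to a basis of I/I^2 then form a basis of
    I/Q over R/I. *)
Lemma conormal_complement xs : conormal_free I -> {in xs, forall a, I a} ->
  rreg [set: R^o] xs -> T `<=` lspan xs (I : set R^o) ->
  exists ys, [/\ {in ys, forall a, I a}, I `<=` lspan (ys ++ xs) [set: R^o]
    & forall c : nat -> R, lspan xs [set: R^o] (\sum_(i < size ys) ys`_i * c i) ->
      forall i, (i < size ys)%N -> I (c i)].
Proof.
move=> freeI xsI reg Txs; have subT := @submT R (R^o : lmodType R).
have [v s' ps c [u su [t Tt def_cv]]|ys [sI Is indep]] := conormal_basis_complete freeI xsI.
  have xv : v \in xs by rewrite (perm_mem ps) inE eqxx.
  have lti : (index v xs < size xs)%N by rewrite index_mem.
  have ps' : perm_eq s' (take (index v xs) xs ++ drop (index v xs).+1 xs).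
    by have := perm_rest v lti; rewrite nth_index // (permPl ps) perm_cons.
  have [a ai0 def_u] : exists2 a : nat -> R, a (index v xs) = 0 &
      u = \sum_(j < size xs) xs`_j * a j.
    apply: (@lspan_min R (R^o : lmodType R) s' setT
      [set w | exists2 a : nat -> R, a (index v xs) = 0 &
        w = \sum_(j < size xs) xs`_j * a j] _ _ u su).
      apply/submoduleP; split; first by exists (fun=> 0); rewrite // big1 // => j _; rewrite mulr0.
      move=> e _ _ [a ai0 ->] [a' ai0' ->]; exists (fun j => e * a j + a' j).
        by rewrite ai0 ai0' mulr0 addr0.
      rewrite [_ *: _]mulr_sumr -big_split; apply: eq_bigr => j _.
      by rewrite mulrDr mulrCA.
    move=> b e; rewrite (perm_mem ps') => /(mem_restP 0 lti)[j [ltj ji ->]] _.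
    exists (fun k => if k == j then e else 0); first by rewrite eq_sym (negPf ji).
    rewrite (bigD1 (Ordinal ltj)) //= eqxx big1 ?addr0 // => k.
    by rewrite -val_eqE /= => /negPf ->; rewrite mulr0.
  pose c' j := if j == index v xs then c else - a j.
  have := @rreg_independent R I xs idI xsI reg c' _ _ lti.
  rewrite /c' eqxx; apply; rewrite (bigD1 (Ordinal lti)) //= eqxx nth_index // mulrC def_cv def_u.
  rewrite (bigD1 (Ordinal lti)) //= ai0 mulr0 add0r addrAC -big_split big1 ?add0r; first exact: Txs.
  by move=> j; rewrite -val_eqE /= => /negPf ->; rewrite mulrN subrr.
exists ys; split=> [a ya|a /Is[u su [t Tt ->]]|c xc i lti].
- by apply: sI; rewrite mem_cat ya.
- apply: (submD (subm_lspan _ subT) su).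
  apply: (lspan_subseq subT _ (lspanS (@subsetT _ _) (Txs t Tt))) => b xb.
  by rewrite mem_cat xb orbT.
have lti' : (i < size (ys ++ xs))%N by rewrite size_cat (leq_trans lti) // leq_addr.
have := perm_rest 0 lti'; rewrite nth_cat lti => /indep; apply.
apply: addSl; first exact: idT.
have -> : c i * ys`_i = \sum_(j < size ys) ys`_j * c j
    - \sum_(j < size ys | j != Ordinal lti) ys`_j * c j.
  by rewrite [in RHS](bigD1 (Ordinal lti)) //= addrK mulrC.
apply: (submB (subm_lspan _ subT)).
  apply: lspan_subseq xc => // b /(nthP 0)[k ltk <-].
  apply/(mem_restP 0 lti'); exists (size ys + k)%N.
  rewrite size_cat ltn_add2l ltk nth_cat ltnNge leq_addr addKn; split=> //.
  by rewrite neq_ltn orbC (leq_trans lti) // leq_addr.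
apply: (@subm_sum R (R^o : lmodType R) _ (subm_lspan _ subT)) => j ji.
apply: (@lspan_mem R (R^o : lmodType R)) => //.
apply/(mem_restP 0 lti'); exists j; rewrite nth_cat ltn_ord; split=> //.
by rewrite size_cat (leq_trans (ltn_ord j)) // leq_addr.
Qed.

End Exchange.

(** * The resolution of R/I as an iterated mapping cone *)

Section Covers.
Variables (R : comNzRingType) (m : set R).
Implicit Types (V W N F G : lmodType R).
Hypotheses (noethR : noetherian_ring R) (localR : local_ring m).
Let idm := local_ideal localR.

Lemma near_id_bij F (f : {linear F -> F}) : ffree F ->
  (forall v, ext F m (f v - v)) -> bijective f.
Proof.
move=> [n [g bij_g]] fm; have [h gK hK] := inverse_linear bij_g.
pose M := lin1_mx (h \o f \o g).
have Mm i j : m (M i j - 1%:M i j).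
  have /(ext_linear h)/(ext_rV _ idm)/(_ j) := fm (g (delta_mx 0 i)).
  rewrite linearB /= gK !mxE /=.
  by rewrite eq_sym.
have [b detb] := det_unit noethR localR Mm.
have fE v : f v = g (h v *m M) by rewrite mul_rV_lin1 /= !hK.
exists (fun v => g (b *: (h v *m \adj M))) => v; rewrite fE ?gK.
  by rewrite -mulmxA mul_mx_adj mul_mx_scalar scalerA mulrC detb scale1r hK.
by rewrite -scalemxAl -mulmxA mul_adj_mx mul_mx_scalar scalerA mulrC detb scale1r hK.
Qed.

Lemma lift_cover F G N (p : {linear F -> N}) (q : {linear G -> N}) : ffree F ->
  range q = setT -> exists f : {linear F -> G}, forall v, q (f v) = p v.
Proof.
move=> freeF surq.
have [|f fP] := lift_free freeF (subm_eq q p); last by exists f.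
by move=> v; have [w _ wv] : range q (p v); [rewrite surq | exists w].
Qed.

(** Each cover lifts through the other, and both composites are the identity modulo m, hence
    bijective. *)
Lemma cover_unique F G N (p : {linear F -> N}) (q : {linear G -> N}) :
  ffree F -> ffree G -> range p = setT -> range q = setT ->
  (forall v, p v = 0 -> ext F m v) -> (forall v, q v = 0 -> ext G m v) ->
  exists2 f : {linear F -> G}, bijective f & forall v, q (f v) = p v.
Proof.
move=> freeF freeG surp surq minp minq.
have [f qf] := lift_cover p freeF surq; have [g pg] := lift_cover q freeG surp.
exists f => //.
have [|h1 gfK _] := @near_id_bij F (g \o f : {linear F -> F}) freeF.
  by move=> v; apply: minp; rewrite linearB /= pg qf subrr.
have [|h2 _ fgK] := @near_id_bij G (f \o g : {linear G -> G}) freeG.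
  by move=> v; apply: minq; rewrite linearB /= qf pg subrr.
exists (fun w => g (h2 w)) => [v|w]; last exact: fgK.
by apply: (can_inj gfK); rewrite /=; congr (g _); exact: fgK.
Qed.

(** Together with the faithfulness of N, this is all that later arguments retain of the
    resolution. *)
Definition self_cover (I : set R) r n N (pi : {linear 'rV[R]_n -> N})
  (nu : {linear {ffun 'I_r -> N} -> 'rV[R]_n}) : Prop :=
  [/\ range pi = setT, injective nu, forall v, pi v = 0 <-> exists w, nu w = v
    & forall w, ext _ I (nu w)].

End Covers.

Section Cone.
Variables (R : comNzRingType) (m I : set R) (xs ys : seq R).
Implicit Types (V W N A : lmodType R).
Hypotheses (noethR : noetherian_ring R) (localR : local_ring m).
Hypothesis idI : ideal I.
Hypothesis Im : I `<=` m.
Hypothesis xsI : {in xs, forall a, I a}.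
Hypothesis ysI : {in ys, forall a, I a}.
Hypothesis exactK : forall k (z : koszul xs k.+1), koszul_d z = 0 -> exists w, koszul_d w = z.
Hypothesis xs_indep : forall c : nat -> R,
  lspan xs (I : set R^o) (\sum_(i < size xs) xs`_i * c i) -> forall i, (i < size xs)%N -> I (c i).
Hypothesis sqI : forall a b, I a -> I b -> lspan xs (I : set R^o) (a * b).
Hypothesis genI : I `<=` lspan (ys ++ xs) [set: R^o].
Hypothesis ys_indep : forall c : nat -> R,
  lspan xs [set: R^o] (\sum_(i < size ys) ys`_i * c i) -> forall i, (i < size ys)%N -> I (c i).
Hypothesis ys_gt0 : (0 < size ys)%N.
Hypothesis faithI : forall a, (forall b, I b -> a * b = 0) -> a = 0.
Local Notation r := (size ys).
Local Notation pow V := {ffun 'I_r -> V}.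

Section Delta.
Variables (k : nat) (A : lmodType R) (phi : {linear pow A -> koszul xs k}).
Variables (j : {linear koszul xs k -> A}) (q : {linear pow A -> A}).

Lemma cone_delta_linear :
  linear (fun b : koszul xs k.+1 * pow A => j (koszul_d b.1 + phi b.2) + q b.2).
Proof.
move=> a u v /=.
rewrite !linearP addrACA -scalerDr linearP addrACA -scalerDr.
by [].
Qed.
(** The differential of the mapping cone: the Koszul part and the comparison map enter A through j,
    and q is the differential of the r copies up to sign. Keeping A, j and q abstract treats the
    first step, where A = K_0, j is the identity and q = 0, like all others. *)
Definition cone_delta : {linear (koszul xs k.+1 * pow A)%type -> A} := lin_of cone_delta_linear.

(* The k-th step of the resolution of R/I: the iterated mapping cone of the comparison maps phi
   from r copies of the resolution to the Koszul complex, along 0 -> (R/I)^r -> R/Q -> R/I -> 0. *)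
Definition cone : Prop :=
  [/\ ffree A, forall b, ext A I (cone_delta b) & forall w, ext _ I (phi w)] /\
  [/\ forall b, exists f, ext _ I f /\ koszul_d f = phi (map_lin _ cone_delta b),
      forall b, cone_delta b = 0 -> exists b', map_lin r cone_delta b' = b.2,
      forall c w, j c + q w = 0 -> c = 0,
      forall b, q (map_lin _ cone_delta b) = 0
    & forall a, (forall b, a *: cone_delta b = 0) -> a = 0].

End Delta.

Section Next.
Variables (k : nat) (A : lmodType R) (phi : {linear pow A -> koszul xs k}).
Variables (j : {linear koszul xs k -> A}) (q : {linear pow A -> A}).
Let B : lmodType R := (koszul xs k.+1 * pow A)%type.
Let dlt := cone_delta phi j q.

Lemma cone_step_linear : linear (fun w : pow B => (0, - map_lin r dlt w) : B).
Proof.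
move=> a u v; rewrite linearP opprD -scalerN; congr pair.
by rewrite /= scaler0 addr0.
Qed.
Definition cone_step : {linear pow B -> B} := lin_of cone_step_linear.

Lemma cone_next : cone phi j q -> exists psi : {linear pow B -> koszul xs k.+1},
  [/\ cone psi (inl_lin _ _) cone_step, forall w, koszul_d (psi w) = phi (map_lin r dlt w)
    & forall b, dlt b = 0 <-> exists b', cone_delta psi (inl_lin _ _) cone_step b' = b].
Proof.
move=> [[freeA dI phiI] [liftA kerA jq qd faithA]].
have freeB : ffree B by apply: ffree_pair; [exact: ffree_koszul | exact: ffree_ffun].
have [||psi psiP] := @lift_free R (pow B) (koszul xs k.+1)
  [set x | ext _ I x.2 /\ koszul_d x.2 = phi (map_lin r dlt x.1)] (ffree_ffun r freeB).
- apply/submoduleP; split=> [|a u v [Iu eu] [Iv ev]] /=.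
    have e0 : koszul_d (0 : koszul xs k.+1) = phi (map_lin r dlt (0 : pow B)) by rewrite !linear0.
    by split; [exact: subm0 | exact: e0].
  have eP : koszul_d (a *: u.2 + v.2) = phi (map_lin r dlt (a *: u.1 + v.1)).
    by rewrite !linearP /= eu ev.
  by split; [exact: submL | exact: eP].
- by move=> b; have [f [If ef]] := liftA b; exists f.
exists psi.
have psiI w : ext _ I (psi w) by case: (psiP w).
have psiE w : koszul_d (psi w) = phi (map_lin r dlt w) by case: (psiP w).
have dltE (u : koszul xs k.+1) (w : pow A) : dlt (u, w) = j (koszul_d u + phi w) + q w by [].
have stepE u w : cone_delta psi (inl_lin _ _) cone_step (u, w)
    = (koszul_d u + psi w, - map_lin r dlt w).
  by apply: injective_projections; rewrite /= ?addr0 ?add0r.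
have dd b' : dlt (cone_delta psi (inl_lin _ _) cone_step b') = 0.
  case: b' => u w; rewrite stepE dltE [koszul_d (koszul_d u + _)]linearD /= koszul_dK add0r psiE.
  by rewrite !linearN subrr linear0 qd oppr0 addr0.
have mapdd b : map_lin r dlt (map_lin r (cone_delta psi (inl_lin _ _) cone_step) b) = 0.
  by apply/ffunP=> i; rewrite !ffunE dd.
(* Once w is the differential of w', the element u + psi w' is a Koszul cycle; a chain bounding it,
   paired with - w', is a preimage of (u, w). *)
have exact_next b : dlt b = 0 -> exists b', cone_delta psi (inl_lin _ _) cone_step b' = b.
  case: b => u w db0; have [w' def_w] := kerA _ db0.
  have z0 : koszul_d (u + psi w') = 0.
    rewrite linearD /= psiE def_w; exact: (jq _ w).
  have [u' def_u] := exactK z0; exists (u', - w').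
  by rewrite stepE !linearN def_u opprK addrK def_w.
split=> [||b]; first split; first split.
- exact: freeB.
- case=> u w; rewrite stepE; apply: ext_pair => /=.
    by apply: submD => //; exact: koszul_d_ext.
  by apply: submN => //; apply: ext_ffun => i; rewrite ffunE; exact: dI.
- exact: psiI.
- split.
  (* This cycle has entries in I^2, so it lies in QI K, and [koszul_d_ext_inv] forces the chain that
     bounds it to have entries in I. *)
  + move=> b; have z0 : koszul_d (psi (map_lin r (cone_delta psi (inl_lin _ _) cone_step) b)) = 0.
      by rewrite psiE mapdd linear0.
    have [f def_f] := exactK z0; exists f; split=> //.
    apply: (koszul_d_ext_inv idI xs_indep); rewrite def_f.
    apply: (mul_ext_linear sqI) => [w|]; first exact: psiI.
    apply: ext_ffun => i; rewrite ffunE.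
    case: (b i) => u w; rewrite stepE; apply: ext_pair => /=.
      by apply: submD => //; exact: koszul_d_ext.
    by apply: submN => //; apply: ext_ffun => l; rewrite ffunE; exact: dI.
  + case=> u w; rewrite stepE => -[_ /eqP]; rewrite oppr_eq0 => /eqP dw0.
    have /choice[b' b'P] i : exists b', cone_delta psi (inl_lin _ _) cone_step b' = w i.
      by apply: exact_next; have /ffunP/(_ i) := dw0; rewrite !ffunE.
    by exists (finfun b'); apply/ffunP=> i; rewrite !ffunE b'P.
  + move=> c w [].
    by rewrite addr0.
  + move=> b; apply: injective_projections => //=.
    by apply/eqP; rewrite oppr_eq0; apply/eqP; exact: mapdd.
  (* As r > 0, the second component of the new differential contains a copy of the old one up to
     sign, so faithfulness is inherited. *)
  + move=> a ad0; apply: faithA => b.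
    have := ad0 (0, const_lin _ r b); rewrite stepE => -[_ /ffunP/(_ (Ordinal ys_gt0))].
    by rewrite !ffunE scalerN => /eqP; rewrite oppr_eq0 => /eqP.
- move=> w; exact: psiE.
- by split=> [|[b' <-]]; [exact: exact_next | exact: dd].
Qed.
End Next.

Lemma cone_start_linear :
  linear (fun w : pow (koszul xs 0) => \sum_(i < r) ys`_i *: w i : koszul xs 0).
Proof.
move=> a u v; rewrite scaler_sumr -big_split; apply: eq_bigr => i _.
by rewrite !ffunE scalerDr !scalerA mulrC.
Qed.
Definition cone_start : {linear pow (koszul xs 0) -> koszul xs 0} := lin_of cone_start_linear.

Lemma zero_linear V W : linear (fun _ : V => 0 : W).
Proof. by move=> a u v; rewrite scaler0 addr0. Qed.
Definition zero_lin V W := lin_of (@zero_linear V W).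

Lemma ext_k0 (z : koszul xs 0) : ext _ I z <-> I (koszul0 z).
Proof.
have [g gK kgK] := inverse_linear (koszul0_bij xs).
split=> [/(ext_linear (@koszul0 R xs))|Iz]; first by rewrite ext_regular.
rewrite -[z]gK; apply: ext_linear.
by rewrite ext_regular.
Qed.

(** Together xs and ys give a surjection of K_1 + K_0^r onto I. The comparison map is the row of the
    ys, and exactness amounts to their independence modulo Q. *)
Lemma cone_base :
  cone cone_start (id_lin _) (zero_lin _ _) /\
  (forall a, I a <-> exists b, koszul0 (cone_delta cone_start (id_lin _) (zero_lin _ _) b) = a).
Proof.
have subT := @submT R (R^o : lmodType R).
set dlt := cone_delta cone_start _ _.
have dltE u w : koszul0 (dlt (u, w)) = koszul0 (koszul_d u) + \sum_(i < r) ys`_i * koszul0 (w i).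
  rewrite /= addr0 linearD linear_sum; congr (_ + _); apply: eq_bigr => i _.
  by rewrite linearZ.
have sum_ext (w : 'I_r -> R) : (forall i, I (w i)) ->
    lspan xs (I : set R^o) (\sum_(i < r) ys`_i * w i).
  move=> Iw; apply: (@subm_sum R (R^o : lmodType R) _ (subm_lspan _ idI)) => i _.
  by apply: sqI => //; apply: ysI; exact: mem_nth.
have dltI b : I (koszul0 (dlt b)).
  case: b => u w; rewrite dltE; apply: (submD idI).
    by have := lspan_ext xsI idI (lspan_koszul_d0 u); rewrite ext_regular.
  apply: (subm_sum idI) => i _; rewrite mulrC; apply: (idealM _ idI).
  by apply: ysI; exact: mem_nth.
have dlt_onto a : I a -> exists b, koszul0 (dlt b) = a.
  have [g gK kgK] := inverse_linear (koszul0_bij xs).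
  move/genI; rewrite (lspan_cat _ _ subT) => -[c yc [e xe ->]].
  have [u _ def_e] := lspan_koszul_d0_lift subT xe.
  have [d _ ->] := proj1 (lspan_sumP _ _ subT) yc.
  exists (u, [ffun i : 'I_r => g (d i)]); rewrite dltE def_e addrC; congr (_ + _).
  by apply: eq_bigr => i _; rewrite ffunE kgK.
split; last by move=> a; split=> [/dlt_onto //|[b <-]].
split; split.
- exact: ffree_koszul.
- by move=> b; apply/ext_k0.
- move=> w; apply: subm_sum => // i _; apply: ext_mem.
  by apply: ysI; exact: mem_nth.
(* Products of the ys with elements of I lie in I^2, hence in QI, so the lift can have its
   coefficients in I. *)
- move=> b; have [] := @lspan_koszul_d0_lift _ xs I (koszul0 (cone_start (map_lin _ dlt b))) idI.
    rewrite /= linear_sum; under eq_bigr => i _ do rewrite linearZ /= ffunE.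
    exact: (sum_ext (fun i => koszul0 (dlt (b i)))).
  move=> u Iu eu; exists u; split=> //.
  by apply: (bij_inj (koszul0_bij xs)).
- case=> u w d0.
  have Iw i : I (koszul0 (w i)).
    pose c n := if insub n is Some i then koszul0 (w i) else 0.
    have cE (l : 'I_r) : c l = koszul0 (w l) by rewrite /c valK.
    rewrite -cE; apply: ys_indep => //.
    under eq_bigr => l _ do rewrite cE.
    have /eqP := dltE u w; rewrite d0 linear0 eq_sym addr_eq0 => /eqP e0.
    rewrite -[X in lspan _ _ X]opprK; apply: (submN (subm_lspan _ subT)).
    by rewrite -e0; exact: lspan_koszul_d0.
  have /choice[b' b'P] i := dlt_onto _ (Iw i).
  exists (finfun b'); apply/ffunP=> i; rewrite !ffunE.
  exact: (bij_inj (koszul0_bij xs)).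
- by move=> c w; rewrite /= addr0.
- by [].
- move=> a ad0; apply: faithI => b /dlt_onto[b' <-].
  by rewrite -[a * _]/(a *: (koszul0 (dlt b') : R^o)) -linearZ ad0 linear0.
Qed.

(** The cone is minimal because I lies in m. Uniqueness of minimal covers therefore matches syzygies
    taken from arbitrary minimal presentations with the images of the cone differentials; I itself
    is the image of the first one. *)
Lemma cone_syzygy (MI : lmodType R) : iso_submodule MI (I : set R^o) ->
  forall k N, is_iter_syzygy m k MI N ->
  exists (A : lmodType R) (phi : {linear pow A -> koszul xs k})
    (j : {linear koszul xs k -> A}) (q : {linear pow A -> A}), cone phi j q /\
    exists2 f : {linear N -> A}, injective f & range f = range (cone_delta phi j q).
Proof.
case=> g injg rangeg; elim=> [|k IHk] N /=.
  case=> f bij_f; have [coneB surB] := cone_base.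
  have [h gK kgK] := inverse_linear (koszul0_bij xs); have [f' fK f'K] := inverse_linear bij_f.
  exists (koszul xs 0), cone_start, (id_lin _), (zero_lin _ _); split=> //.
  exists (h \o g \o f' : {linear N -> koszul xs 0}).
    by apply: inj_comp (can_inj f'K); apply: inj_comp injg; exact: (can_inj kgK).
  apply/seteqP; split=> _ [v _ <-].
    have /surB[b eb] : I (g (f' v)) by rewrite -[I]rangeg; exists (f' v).
    by exists b => //=; rewrite -[RHS]/(h (g (f' v))) -eb gK.
  have : I (koszul0 (cone_delta cone_start (id_lin _) (zero_lin _ _) v)) by apply/surB; exists v.
  rewrite -[I]rangeg => -[z _ ez]; exists (f z) => //.
  by rewrite /= fK ez gK.
case=> L /IHk[A [phi [j [q [coneA [f injf rangef]]]]]].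
case=> n1 [n0 [M [pi [[surpi kerpi minpi _] [e inje rangee]]]]].
have [psi [coneB psiE ker_delta]] := cone_next coneA.
set B : lmodType R := (koszul xs k.+1 * pow A)%type in coneB ker_delta.
have [p fp] : exists p : {linear B -> L}, forall b, f (p b) = cone_delta phi j q b.
  by apply: factor_inj => // b; rewrite rangef; exists b.
have kerp b : p b = 0 <-> cone_delta phi j q b = 0.
  rewrite -fp; split=> [->|e0]; first by rewrite linear0.
  by apply: injf; rewrite e0 linear0.
have [[_ dI _] _] := coneB.
have freeB : ffree B.
  by case: coneB => [[]].
have extIm V (v : V) : ext V I v -> ext V m v by apply: smulS.
have surp : range p = setT.
  apply/seteqP; split=> // l _; have : range f (f l) by exists l.
  by rewrite rangef => -[b _ eb]; exists b => //; apply: injf; rewrite fp.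
have [||F bijF pF] := cover_unique noethR localR (ffree_rV R n0) freeB surpi surp.
- by move=> v /minpi mv; apply/ext_rV => //; exact: local_ideal.
- by move=> b /kerp/ker_delta[b' <-]; apply: extIm.
exists B, psi, (inl_lin _ _), (cone_step phi j q); split=> //.
exists (F \o e : {linear N -> B}); first by apply: inj_comp inje; exact: bij_inj.
apply/seteqP; split=> [_ [v _ <-]|b [b' _ eb']].
  have [u _ eu] : range (fun u : 'rV[R]_n1 => u *m M) (e v) by rewrite -rangee; exists v.
  have : cone_delta phi j q (F (e v)) = 0.
    by apply/kerp; rewrite pF; apply/kerpi; exists u.
  by case/ker_delta => b' eb'; exists b'.
have db0 : cone_delta phi j q b = 0 by apply/ker_delta; exists b'.
have [F' FK F'K] := bijF.
have : range (fun u : 'rV[R]_n1 => u *m M) (F' b).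
  have /kerpi[u ->] : pi (F' b) = 0 by rewrite -pF F'K; apply/kerp.
  by exists u.
by rewrite -rangee => -[v _ ev]; exists v; rewrite //= ev F'K.
Qed.

(** Here K vanishes in degree k + 2, so the next differential is w |-> (psi w, - delta^r w) on B^r.
    Its kernel is that of delta^r, so it induces an injection of N^r, the image of delta^r, into
    B. *)
Lemma cone_self_cover k A (phi : {linear pow A -> koszul xs k}) (j : {linear koszul xs k -> A})
    (q : {linear pow A -> A}) N (f : {linear N -> A}) :
  cone phi j q -> injective f -> range f = range (cone_delta phi j q) -> (size xs <= k.+1)%N ->
  (forall a, (forall v : N, a *: v = 0) -> a = 0) /\
  exists n (pi : {linear 'rV[R]_n -> N}) (nu : {linear pow N -> 'rV[R]_n}), self_cover I pi nu.
Proof.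
move=> coneA injf rangef size_k; split.
  move=> a aN; have [_ [_ _ _ _ faithA]] := coneA; apply: faithA => b.
  have : range f (cone_delta phi j q b) by rewrite rangef; exists b.
  by case=> v _ <-; rewrite -linearZ aN linear0.
have [psi [coneB psiE ker_delta]] := cone_next coneA.
set B : lmodType R := (koszul xs k.+1 * pow A)%type in coneB ker_delta.
have [[[n [g bij_g]] dI _] _] := coneB; have [h gK hK] := inverse_linear bij_g.
set dlt := cone_delta phi j q in rangef ker_delta psiE.
set dlt' := cone_delta psi _ _ in dI ker_delta.
have fdl v : exists b, dlt b = f v.
  by have : range f (f v); [exists v | rewrite rangef => -[b _ <-]; exists b].
have dlt'E b' : dlt' b' = dlt' (0, b'.2).
  by case: b' => u w; rewrite [u]koszul_zero.
(* If delta^r w = 0, then psi w is a Koszul cycle, hence a boundary from degree k + 2, where K is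
   zero. *)
have dlt'0 w : map_lin r dlt w = 0 -> dlt' (0, w) = 0.
  move=> w0; have psi0 : psi w = 0.
    have [z <-] : exists z, koszul_d z = psi w by apply: exactK; rewrite psiE w0 linear0.
    by rewrite [z]koszul_zero // linear0.
  apply: injective_projections; rewrite /= ?linear0 ?psi0 ?addr0 // add0r.
  by apply/eqP; rewrite oppr_eq0; apply/eqP.
have [pi fpi] : exists pi : {linear 'rV[R]_n -> N}, forall v, f (pi v) = dlt (g v).
  by apply: (@factor_inj _ _ _ _ f (dlt \o g)) => // v; rewrite rangef; exists (g v).
(* The value at w is the next differential at any lift of w to B^r; [dlt'0] makes it independent of
   the lift. *)
have [nu nuP] : exists nu : {linear pow N -> 'rV[R]_n},
    forall w, exists b, map_lin r dlt b = map_lin r f w /\ g (nu w) = dlt' (0, b).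
  have [||l|nu nuP] := @exists_linear R (pow N) 'rV[R]_n
      [set x | exists b, map_lin r dlt b = map_lin r f x.1 /\ g x.2 = dlt' (0, b)].
  - apply/submoduleP; split.
      exists 0; split; first by rewrite [LHS]linear0 [RHS]linear0.
      by rewrite [LHS]linear0 [RHS]linear0.
    move=> a u v [b [eb gb]] [c [ec gc]]; exists (a *: b + c); split.
      by rewrite [LHS]linearP [RHS]linearP eb ec.
    have -> : (0, a *: b + c) = a *: ((0, b) : (koszul xs k.+2 * pow B)%type) + (0, c).
      by congr pair; rewrite /= scaler0 addr0.
    by rewrite [LHS]linearP [RHS]linearP gb gc.
  - move=> w; have /choice[b bP] i := fdl (w i).
    exists (h (dlt' (0, finfun b))), (finfun b); split; last by rewrite /= hK.
    by apply/ffunP=> i; rewrite !ffunE bP.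
  - case=> b [eb gl]; apply: (bij_inj bij_g); rewrite linear0; apply: etrans gl _.
    by apply: dlt'0; apply: etrans eb (linear0 _).
  by exists nu.
exists n, pi, nu; split=> [||v|w].
- apply/seteqP; split=> // v _; have [b eb] := fdl v; exists (h b) => //.
  by apply: injf; rewrite fpi hK.
- move=> w w' eqw; apply/subr0_eq/ffunP=> i.
  have [b [eb gb]] := nuP (w - w').
  move: gb; rewrite linearB eqw subrr linear0 => /esym/(congr1 (@snd _ _)) /=.
  rewrite add0r => /eqP; rewrite oppr_eq0 => /eqP; rewrite -[X in X = _]/(map_lin r dlt b) eb.
  by move/ffunP/(_ i); rewrite !ffunE -[0 in RHS](linear0 f) => /injf.
- split=> [pv0|[w <-]].
    have : dlt (g v) = 0 by rewrite -fpi pv0 linear0.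
    case/ker_delta => b'; rewrite -/dlt' dlt'E => eb'.
    have /choice[w wP] i : exists l, f l = dlt (b'.2 i).
      by have : range f (dlt (b'.2 i)); [rewrite rangef; exists (b'.2 i) | case=> l _ el; exists l].
    exists (finfun w); apply: (bij_inj bij_g); rewrite -eb'.
    have [b [eb ->]] := nuP (finfun w).
    apply/subr0_eq; rewrite -linearB.
    have -> : (0, b) - (0, b'.2) = (0, b - b'.2) :> (koszul xs k.+2 * pow B)%type.
      by congr pair; rewrite /= subr0.
    apply: dlt'0; rewrite linearB eb; apply/subr0_eq/ffunP=> i.
    by rewrite subr0 !ffunE wP subrr.
  have [b [_ gb]] := nuP w.
  apply: injf; rewrite fpi gb linear0; apply/ker_delta.
  by exists (0, b).
have [b [_ gb]] := nuP w.
by rewrite -[nu w]gK gb; apply: ext_linear.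
Qed.

End Cone.

(** * Modules N with a presentation 0 -> N^r -> R^n -> N -> 0 *)

Section Powers.
Variables (R : comNzRingType) (r : nat).
Implicit Types (V W N : lmodType R) (xs : seq R).

Lemma lspan_rV n xs (v : 'rV[R]_n) :
  lspan xs [set: 'rV[R]_n] v <-> forall j, lspan xs [set: R^o] (v 0 j).
Proof.
split=> [xv j|xv].
  have cL : linear (fun v : 'rV[R]_n => v 0 j : R^o) by move=> a u w; rewrite !mxE.
  exact: (lspan_linear (f := lin_of cL) _ xv).
rewrite [v]row_sum_delta; apply: subm_sum => [|j _]; first by apply: subm_lspan; exact: submT.
exact: (lspan_linear (f := point_lin (delta_mx 0 j : 'rV[R]_n)) _ (xv j)).
Qed.

Lemma rreg_rV n xs : rreg [set: R^o] xs -> rreg [set: 'rV[R]_n] xs.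
Proof.
elim: xs => //= x xs IHxs [xreg reg]; split; last exact: IHxs.
move=> v _ /lspan_rV xv; apply/lspan_rV => j; apply: xreg => //.
by have := xv j; rewrite mxE.
Qed.

Definition powS V (D : set V) : set {ffun 'I_r -> V} := [set w | forall i, D (w i)].

Lemma powS_setT V : powS [set: V] = setT.
Proof. by apply/seteqP; split=> // w _ i. Qed.

Lemma lspan_pow V (D : set V) xs (w : {ffun 'I_r -> V}) : submodule D ->
  lspan xs (powS D) w <-> forall i, lspan xs D (w i).
Proof.
move=> subD; split=> [xw i|xw].
  by apply: (lspan_linear (f := ev_lin V i) _ xw) => u; exact.
have subP : submodule (powS D).
  apply/submoduleP; split=> [i|a u v Du Dv i]; first by rewrite ffunE; exact: subm0.
  by rewrite !ffunE; exact: submL.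
rewrite (ffun_sum_in w); apply: subm_sum => [|i _]; first exact: subm_lspan.
apply: (lspan_linear (f := in_lin V i) _ (xw i)) => u Du j; rewrite ffunE.
by case: eqP => // _; exact: subm0.
Qed.

Lemma rreg_powS V (D : set V) xs : submodule D -> rreg D xs -> rreg (powS D) xs.
Proof.
move=> subD; elim: xs => //= x xs IHxs [xreg reg]; split; last exact: IHxs.
move=> w Dw /(lspan_pow _ _ subD) xw; apply/(lspan_pow _ _ subD) => i; apply: xreg => //.
by have := xw i; rewrite ffunE.
Qed.

Lemma rreg_of_powS V (D : set V) xs : (0 < r)%N -> submodule D ->
  rreg (powS D) xs -> rreg D xs.
Proof.
move=> r_gt0 subD; elim: xs => //= x xs IHxs [xreg reg]; split; last exact: IHxs.
move=> v Dv xv; have : lspan xs (powS D) (const_lin _ r v).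
  apply: xreg; first by move=> i; rewrite ffunE.
  by apply/(lspan_pow _ _ subD) => i; rewrite !ffunE.
by move/(lspan_pow _ _ subD)/(_ (Ordinal r_gt0)); rewrite ffunE.
Qed.

Lemma mul_into_powS V (D : set V) (I : set R) xs : submodule D ->
  mul_into I xs D -> mul_into I xs (powS D).
Proof.
move=> subD DI a w Ia Dw; apply/(lspan_pow _ _ subD) => i; rewrite ffunE.
exact: DI.
Qed.

Lemma mul_into_of_powS V (D : set V) (I : set R) xs : (0 < r)%N -> submodule D ->
  mul_into I xs (powS D) -> mul_into I xs D.
Proof.
move=> r_gt0 subD DI a v Ia Dv; have : lspan xs (powS D) (a *: const_lin _ r v).
  by apply: DI => // i; rewrite ffunE.
by move/(lspan_pow _ _ subD)/(_ (Ordinal r_gt0)); rewrite !ffunE.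
Qed.

End Powers.

Section SelfCover.
Variables (R : comNzRingType) (I : set R) (r n : nat) (N : lmodType R).
Variables (pi : {linear 'rV[R]_n -> N}) (nu : {linear {ffun 'I_r -> N} -> 'rV[R]_n}).
Implicit Types (V W E C : lmodType R) (xs : seq R).
Hypotheses (idI : ideal I) (r_gt0 : (0 < r)%N) (cover : self_cover I pi nu).
Local Notation i0 := (Ordinal r_gt0).

Let surpi : range pi = setT. Proof. by case: cover. Qed.
Let injnu : injective nu. Proof. by case: cover. Qed.
Let kerpi v : pi v = 0 <-> exists w, nu w = v. Proof. by case: cover. Qed.
Let nuI w : ext _ I (nu w). Proof. by case: cover. Qed.
Let pinu w : pi (nu w) = 0. Proof. by apply/kerpi; exists w. Qed.
Let subT V := @submT R V.

Let ker_range : [set v | setT v /\ pi v = 0] = range nu.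
Proof.
apply/seteqP; split=> [v [_ /kerpi[w <-]]|_ [w _ <-]]; first by exists w.
by split.
Qed.

Let nu_ker w : nu w = 0 <-> id_lin {ffun 'I_r -> N} w = 0.
Proof. by split=> [e0|/= ->]; [apply: injnu; rewrite e0 linear0 | rewrite linear0]. Qed.

Let range_id V : range (id_lin V) = setT.
Proof. by apply/seteqP; split=> // v _; exists v. Qed.

(* In 0 -> N^r -> R^n -> N -> 0, regularity of the tail of xs on N gives regularity of xs on N^r,
   hence on N. *)
Lemma self_cover_rreg xs : rreg [set: R^o] xs -> rreg [set: N] xs.
Proof.
elim: xs => // x xs IHxs /= [xreg reg].
apply: (@rreg_of_powS R r _ setT (x :: xs)) => //.
rewrite powS_setT -range_id.
apply: (rreg_transfer nu_ker); rewrite -ker_range.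
apply: rreg_ker_cons => //; first exact: (@rreg_rV R n (x :: xs)).
by rewrite surpi; exact: IHxs.
Qed.

Lemma ext_mul_lspan V xs a (v : V) :
  (forall a b, I a -> I b -> lspan xs (I : set R^o) (a * b)) ->
  I a -> ext V I v -> lspan xs setT (a *: v).
Proof. by move=> sqI Ia Iv; apply: (lspanS (@subsetT _ (ext V I))); exact: mul_ext. Qed.

Lemma self_cover_mul_into xs : rreg [set: R^o] xs ->
  (forall a b, I a -> I b -> lspan xs (I : set R^o) (a * b)) -> mul_into I xs [set: N].
Proof.
move=> reg sqI; apply: (mul_into_of_powS r_gt0) => //; rewrite powS_setT -range_id.
apply: (@mul_into_transfer R _ _ _ nu) => [w /nu_ker //|].
rewrite -ker_range => a v Ia [_ pv0].
apply: lspan_ker => //; first by rewrite surpi; exact: self_cover_rreg.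
  by split=> //; rewrite linearZ /= pv0 scaler0.
apply: ext_mul_lspan => //; have /kerpi[w <-] := pv0; exact: nuI.
Qed.

(* Ext^1(N, V) = 0: dimension shifting along 0 -> V -> E -> C -> 0 replaces Ext^1(N, V) by
   Ext^1(N^r, V) = Ext^2(N, V) = Ext^1(N, C). *)
Lemma extend_along_self_cover V : finite_injective_dim V ->
  forall g : {linear {ffun 'I_r -> N} -> V},
    exists h : {linear 'rV[R]_n -> V}, forall w, h (nu w) = g w.
Proof.
elim=> {V} [V injV g|V E C f e injE injf exact_fe sure _ IHC g]; first exact: injV.
have [h hnu] := injE _ _ nu (f \o g) injnu.
have [hbar hpi] : exists hbar : {linear N -> C}, forall v, hbar (pi v) = e (h v).
  apply: (factor_surj (g := e \o h)) => // v /kerpi[w <-] /=.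
  by rewrite hnu; apply/exact_fe; exists (g w).
(* Composed with nu and the inclusion of the copy i0 of N, the map t' lifts hbar through e.
   Subtracting this lift, pulled back by pi, from h leaves a map into the image of f, and changes
   nothing on the image of nu since pi nu = 0. *)
have [t tnu] := IHC (hbar \o ev_lin N i0).
have [t' et'] := lift_cover t (ffree_rV R n) sure.
have [|h' fh'] := @factor_inj _ _ _ _ f (h \- (t' \o nu \o in_lin N i0 \o pi)) injf.
  move=> v; apply/exact_fe; rewrite /= linearB /= et' tnu /= ffunE eqxx hpi subrr.
  by [].
exists h' => w; apply: injf; rewrite fh'.
by rewrite -[LHS]/(h (nu w) - t' (nu (in_lin N i0 (pi (nu w))))) pinu hnu !linear0 addr0.
Qed.

(** * The dual of N and the module lambda N *)

Section Dual.
Variables (n1 : nat) (A : 'M[R]_(n1, n)) (L : lmodType R) (f : {linear L -> 'rV[R]_n1}).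
Hypothesis kerpiA : forall v, pi v = 0 <-> exists u : 'rV[R]_n1, v = u *m A.
Hypotheses (injf : injective f) (rangef : range f = range (fun v : 'rV[R]_n => v *m A^T)).
Hypothesis injdimR : finite_injective_dim (R^o : lmodType R).

Lemma row_ext p (u v : 'rV[R]_p) : (forall e : 'rV[R]_p, e *m u^T = e *m v^T) -> u = v.
Proof.
move=> uv; apply/rowP=> k; have /matrixP/(_ 0 0) := uv (delta_mx 0 k).
by rewrite -!rowE !mxE.
Qed.

Let M i : 'M[R]_n := lin1_mx (nu \o in_lin N i \o pi).
Let ME i e : e *m M i = nu (in_lin N i (pi e)). Proof. by rewrite mul_rV_lin1. Qed.

(** Restriction of functionals along nu: the i-th component of the image of v is v on the i-th copy
    of N, pulled back to R^n by pi. This is the map R^n -> D^r of the dual presentation. *)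
Lemma dual_linear :
  linear (fun v : 'rV[R]_n => [ffun i => v *m (M i)^T] : {ffun 'I_r -> 'rV[R]_n}).
Proof. by move=> a u v; apply/ffunP=> i; rewrite !ffunE mulmxDl scalemxAl. Qed.
Let theta := lin_of dual_linear.

Let thetaE e v i : e *m (theta v i)^T = nu (in_lin N i (pi e)) *m v^T.
Proof. by rewrite ffunE trmx_mul trmxK mulmxA ME. Qed.

Lemma subm_dual : submodule [set v : 'rV[R]_n | v *m A^T = 0].
Proof.
apply/submoduleP; split=> [|a u v] /=; first by rewrite mul0mx.
by rewrite mulmxDl -scalemxAl => -> ->; rewrite scaler0 addr0.
Qed.
(** A row vector v is the functional e |-> e v^T. Those vanishing on the rows of A are the
    functionals on N, so D is N^*. *)
Let D := [set v : 'rV[R]_n | v *m A^T = 0].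

Let DP v : D v <-> forall w, nu w *m v^T = 0.
Proof.
split=> [Dv w|Dv].
  have /kerpiA[u ->] := pinu w.
  by rewrite -mulmxA -[A]trmxK -trmx_mul Dv trmx0 mulmx0.
apply: row_ext => u; rewrite trmx0 mulmx0 trmx_mul trmxK mulmxA.
have /kerpi[w <-] : pi (u *m A) = 0 by apply/kerpiA; exists u.
exact: Dv.
Qed.

Let theta_ker v : theta v = 0 <-> D v.
Proof.
split=> [v0|/DP Dv]; last first.
  apply/ffunP=> i; rewrite [RHS]ffunE; apply: row_ext => e.
  by rewrite thetaE Dv trmx0 mulmx0.
apply/DP=> w; rewrite (ffun_sum_in w) linear_sum mulmx_suml big1 // => i _.
have : range pi (w i) by rewrite surpi.
by case=> e _ <-; rewrite -thetaE v0 ffunE trmx0 mulmx0.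
Qed.

(** Surjectivity is where R being Gorenstein enters: r functionals on N form one map N^r -> R, which
    extends along nu to R^n. *)
Let theta_range : range theta = powS D.
Proof.
apply/seteqP; split=> [_ [v _ <-] i|phi Dphi].
  by apply/DP => w; rewrite thetaE pinu (linear0 (in_lin N i)) linear0 mul0mx.
have /choice[phib phibP] i :
    exists g : {linear N -> R^o}, forall e, g (pi e) = (e *m (phi i)^T) 0 0.
  have phiL : linear (fun e : 'rV[R]_n => (e *m (phi i)^T) 0 0 : R^o).
    by move=> a u v; rewrite mulmxDl -scalemxAl !mxE.
  apply: (factor_surj (g := lin_of phiL)) => // v /kerpi[w <-] /=.
  by rewrite (proj1 (DP _) (Dphi i)) mxE.
have gL : linear (fun w : {ffun 'I_r -> N} => \sum_i phib i (w i) : R^o).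
  move=> a u v; rewrite scaler_sumr -big_split; apply: eq_bigr => i _.
  by rewrite !ffunE linearP.
have [h hnu] := extend_along_self_cover injdimR (lin_of gL).
pose v : 'rV[R]_n := \row_k h (delta_mx 0 k).
have hv u : h u = (u *m v^T) 0 0.
  rewrite {1}[u]row_sum_delta linear_sum mxE; apply: eq_bigr => k _.
  by rewrite linearZ !mxE.
exists v => //; apply/ffunP=> i; apply: row_ext => e; apply/matrixP=> a b.
rewrite !ord1 thetaE -hv hnu /= (bigD1 i) //= big1 => [|k].
  by rewrite addr0 ffunE eqxx phibP.
by rewrite ffunE => /negPf ->; rewrite linear0.
Qed.

Let ker_theta_set : [set v | setT v /\ theta v = 0] = D.
Proof. by apply/seteqP; split=> v; [case=> _ /theta_ker | move/theta_ker]. Qed.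

Lemma dual_rreg xs : rreg [set: R^o] xs -> rreg D xs.
Proof.
elim: xs => // x xs IHxs /= [xreg reg]; rewrite -ker_theta_set.
apply: (@rreg_ker_cons R _ _ setT theta _ x xs) => //; first exact: (@rreg_rV R n (x :: xs)).
by rewrite theta_range; apply: rreg_powS; [exact: subm_dual | exact: IHxs].
Qed.

(** Because [theta] maps onto D^r, each element of D is a component of some value of [theta]; the
    matrices M i have entries in I, their rows being values of nu. *)
Lemma dual_ext v : D v -> ext _ I v.
Proof.
move=> Dv; have : powS D (const_lin _ r v) by move=> i; rewrite ffunE.
rewrite -theta_range => -[u _ /ffunP/(_ i0)]; rewrite !ffunE => <-.
apply/(ext_rV _ idI) => k; rewrite mxE; apply: (subm_sum idI) => l _; apply: (idealM _ idI).
rewrite !mxE /=; move: l; apply/(ext_rV _ idI); exact: nuI.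
Qed.

Lemma dual_mul_into xs : rreg [set: R^o] xs ->
  (forall a b, I a -> I b -> lspan xs (I : set R^o) (a * b)) -> mul_into I xs D.
Proof.
move=> reg sqI a v Ia Dv; rewrite -ker_theta_set.
apply: lspan_ker => //.
- by rewrite theta_range; apply: rreg_powS; [exact: subm_dual | exact: dual_rreg].
- by split=> //; apply/theta_ker; apply: submZ => //; exact: subm_dual.
by apply: ext_mul_lspan => //; exact: dual_ext.
Qed.

Lemma dual_good xs : rreg [set: R^o] xs ->
  (forall a b, I a -> I b -> lspan xs (I : set R^o) (a * b)) ->
  (forall a, (forall v : N, a *: v = 0) -> a = 0) ->
  [/\ rreg [set: L] xs, mul_into I xs [set: L], forall a, (forall v : L, a *: v = 0) -> a = 0
    & exists2 rho : {linear 'rV[R]_n -> L}, range rho = setT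
      & forall v, rho v = 0 -> ext _ I v].
Proof.
move=> reg sqI faithN.
have AL : linear (fun v : 'rV[R]_n => v *m A^T).
  by move=> a u v; rewrite mulmxDl scalemxAl.
have [|rho frho] := @factor_inj R L _ _ f (lin_of AL) injf.
  by move=> v; rewrite rangef; exists v.
have rho_ker v : rho v = 0 <-> D v.
  have /= frhov := frho v.
  by rewrite /D /= -frhov; split=> [->|e0]; [rewrite linear0 | apply: injf; rewrite e0 linear0].
have surrho : range rho = setT.
  apply/seteqP; split=> // l _; have : range f (f l) by exists l.
  by rewrite rangef => -[v _ ev]; exists v => //; apply: injf; rewrite frho.
(* Both maps have kernel D, so L is isomorphic to D^r. *)
have theta_rho v : theta v = 0 <-> rho v = 0.
  by split=> [/theta_ker/rho_ker|/rho_ker/theta_ker].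
split.
- rewrite -surrho; apply: (rreg_transfer theta_rho); rewrite theta_range.
  by apply: rreg_powS; [exact: subm_dual | exact: dual_rreg].
- rewrite -surrho; apply: (@mul_into_transfer R _ _ _ theta rho) => [v /theta_rho //|].
  by rewrite theta_range; apply: mul_into_powS; [exact: subm_dual | exact: dual_mul_into].
(* If a kills L, it kills the image of A^T, so a A = 0. Then a kills ker pi, into which nu embeds a
   copy of N. *)
- move=> a aL; apply: faithN => v.
  have aA : a *: A = 0.
    rewrite -[A]trmxK -linearZ /=; apply/eqP; rewrite trmx_eq0; apply/eqP/row_matrixP=> i.
    by rewrite row0 rowE -scalemxAr -[_ *m _]/(lin_of AL _) -frho -linearZ aL linear0.
  have : in_lin N i0 (a *: v) = 0.
    have e1 : in_lin N i0 (a *: v) = a *: in_lin N i0 v by rewrite linearZ.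
    have e2 : nu (a *: in_lin N i0 v) = a *: nu (in_lin N i0 v) by rewrite linearZ.
    apply: injnu; rewrite linear0 e1 e2.
    by have /kerpiA[u ->] := pinu (in_lin N i0 v); rewrite scalemxAr aA mulmx0.
  by move/ffunP/(_ i0); rewrite !ffunE eqxx.
by exists rho => // v /rho_ker; exact: dual_ext.
Qed.

End Dual.

End SelfCover.

(** * Quasi-regularity and lengths *)

Section Monomials.
Variable R : comNzRingType.
Implicit Types (V : lmodType R) (xs : seq R).

(** A list of formal monomials: two with equal values count twice, as the computation of lengths
    requires. *)
Fixpoint monomials xs : nat -> seq R :=
  match xs with
  | [::] => fun k => if k is 0 then [:: 1] else [::]
  | x :: xs' => fix M k :=
      match k with 0 => [:: 1] | k'.+1 => monomials xs' k'.+1 ++ [seq x * a | a <- M k'] end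
  end.

Lemma monomials_0 xs : monomials xs 0 = [:: 1]. Proof. by case: xs. Qed.

Lemma monomials_S x xs k : monomials (x :: xs) k.+1 =
  monomials xs k.+1 ++ [seq x * a | a <- monomials (x :: xs) k].
Proof. by []. Qed.

Lemma size_monomials xs k : size (monomials xs k) = 'C((size xs + k).-1, k).
Proof.
elim: xs k => [|x xs IHxs]; first by case=> [|k] //=; rewrite bin_small.
elim=> [|k IHk]; first by rewrite monomials_0 bin0.
by rewrite monomials_S size_cat size_map IHk IHxs
  -[size (x :: xs)]/((size xs).+1) !addSn !addnS /= binS.
Qed.

Section Quasi.
Variable V : lmodType R.
Let T := [set: V].
Let subT : submodule T := @submT R V.
Let subP s : submodule (lspan s T) := subm_lspan s subT.

Lemma lspan1 (v : V) : lspan [:: 1] T v.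
Proof. by exists v => //; exists 0; rewrite //= scale1r addr0. Qed.

Lemma lspan_map x s (v : V) : lspan [seq x * a | a <- s] T v <->
  exists2 w, lspan s T w & v = x *: w.
Proof.
split; last first.
  case=> w sw ->; apply: (@lspan_min R V s T
    [set w | lspan [seq x * a | a <- s] T (x *: w)] _ _ _ sw).
    exact: subm_scale.
  by move=> a u sa _ /=; rewrite scalerA; apply: lspan_mem => //; apply: map_f.
move: v; apply: (@lspan_min R V _ T [set v | exists2 w, lspan s T w & v = x *: w]).
  apply/submoduleP; split; first by exists 0; rewrite ?scaler0 //; exact: subm0.
  move=> a _ _ [u su ->] [v sv ->]; exists (a *: u + v); first exact: submL.
  by rewrite scalerDr !scalerA mulrC.
by move=> _ v /mapP[a sa ->] _; exists (a *: v); [exact: lspan_mem | rewrite scalerA].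
Qed.

Lemma lspan_monomials_S x xs k (v : V) : lspan (monomials (x :: xs) k.+1) T v <->
  exists a b, [/\ lspan (monomials xs k.+1) T a, lspan (monomials (x :: xs) k) T b
    & v = a + x *: b].
Proof.
rewrite monomials_S lspan_cat //; split.
  by case=> a Ma [_ /lspan_map[b Mb ->] ->]; exists a, b.
by case=> a [b [Ma Mb ->]]; exists a => //; exists (x *: b) => //; apply/lspan_map; exists b.
Qed.

Lemma lspan_monomials_cons x xs k (v : V) : lspan (monomials xs k) T v ->
  lspan (monomials (x :: xs) k) T v.
Proof.
case: k => [|k]; first by rewrite !monomials_0.
by move=> Mv; apply/lspan_monomials_S; exists v, 0; split; rewrite ?scaler0 ?addr0 //; exact: subm0.
Qed.

Lemma lspan_monomials_1 xs : lspan (monomials xs 1) T = lspan xs T.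
Proof.
elim: xs => // x xs IHxs; apply/seteqP; split=> v.
  case/lspan_monomials_S => a [b [Ma _ ->]]; exists b => //.
  by exists a; [rewrite -IHxs | rewrite addrC].
case=> b _ [a Ma ->]; apply/lspan_monomials_S; exists a, b; rewrite IHxs monomials_0 addrC.
by split=> //; exact: lspan1.
Qed.

Lemma lspan_monomials_mul x xs k (v : V) : x \in xs ->
  lspan (monomials xs k) T v -> lspan (monomials xs k.+1) T (x *: v).
Proof.
elim: xs k v => // y xs IHxs k v; rewrite inE => /orP[/eqP->|xs_x] Mv.
  by apply/lspan_monomials_S; exists 0, v; rewrite add0r; split=> //; exact: subm0.
elim: k v Mv => [|k IHk] v Mv.
  apply/lspan_monomials_S; exists (x *: v), 0; rewrite scaler0 addr0 lspan_monomials_1.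
  by split=> //; [exact: lspan_mem | exact: subm0].
case/lspan_monomials_S: Mv => a [b [Ma Mb ->]]; apply/lspan_monomials_S.
exists (x *: a), (x *: b); split; [exact: IHxs | exact: IHk |].
by rewrite scalerDr !scalerA mulrC.
Qed.

Lemma lspan_monomials_span xs k :
  lspan (monomials xs k) (lspan xs T) `<=` lspan (monomials xs k.+1) T.
Proof.
apply: lspan_min; first exact: subP.
move=> a v Ma; apply: (@lspan_min R V xs T [set v | lspan (monomials xs k.+1) T (a *: v)]).
  exact: subm_scale.
move=> x u xs_x _ /=; rewrite scalerA mulrC -scalerA; apply: lspan_monomials_mul => //.
exact: lspan_mem.
Qed.

Lemma lspan_monomials_le xs k : lspan (monomials xs k.+1) T `<=` lspan (monomials xs k) T.
Proof.
elim: xs k => [|x xs IHxs] k.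
  by move=> v /= ->; exact: subm0.
elim: k => [|k IHk] v; first by move=> _; rewrite monomials_0; exact: lspan1.
case/lspan_monomials_S => a [b [Ma Mb ->]]; apply/lspan_monomials_S; exists a, b.
by split=> //; [exact: IHxs | exact: IHk].
Qed.

Definition lcomb s (v : nat -> V) : V := \sum_(i < size s) s`_i *: v i.

Lemma lcomb_cat s s' v : lcomb (s ++ s') v = lcomb s v + lcomb s' (fun i => v (size s + i)%N).
Proof.
rewrite /lcomb size_cat big_split_ord /=; congr (_ + _); apply: eq_bigr => i _.
  by rewrite nth_cat ltn_ord.
by rewrite nth_cat ltnNge leq_addr addKn.
Qed.

Lemma lcomb_map x s v : lcomb [seq x * a | a <- s] v = x *: lcomb s v.
Proof.
rewrite /lcomb size_map scaler_sumr; apply: eq_bigr => i _.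
by rewrite (nth_map 0) // scalerA.
Qed.

Lemma lspan_lcomb s v : lspan s T v <-> exists c, v = lcomb s c.
Proof.
rewrite lspan_sumP //; split=> [[c _ ->]|[c ->]]; by [exists c | exists c].
Qed.

(** With Q = (xs), this says that gr_Q(V) is the module of polynomials over V/QV. *)
Definition quasi_regular xs : Prop := forall k (v : nat -> V),
  lspan (monomials xs k.+1) T (lcomb (monomials xs k) v) ->
  forall i, (i < size (monomials xs k))%N -> lspan xs T (v i).

(** Once v is written on the monomials of degree k, quasi-regularity puts x times its coefficients
    into (xs) V, where x cancels; so v climbs one power at a time. *)
Lemma quasi_regular_power x xs k v : quasi_regular xs ->
  (forall u, T u -> lspan xs T (x *: u) -> lspan xs T u) ->
  lspan (monomials xs k) T (x *: v) -> lspan (monomials xs k) T v.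
Proof.
move=> qr xreg; elim: k => [|k IHk] Mxv; first by rewrite monomials_0; exact: lspan1.
have /lspan_lcomb[c def_v] := IHk (lspan_monomials_le Mxv).
apply: lspan_monomials_span; rewrite def_v.
have Mc i : (i < size (monomials xs k))%N -> lspan xs T (c i).
  move=> lti; apply: xreg => //; apply: (qr k (fun i => x *: c i)) lti.
  congr (lspan _ T _): Mxv; rewrite def_v /lcomb scaler_sumr; apply: eq_bigr => l _.
  by rewrite !scalerA mulrC.
apply: subm_sum => [|l _]; first exact: subm_lspan.
by apply: lspan_mem => //; [exact: mem_nth | exact: Mc].
Qed.

(** Double induction, on the sequence and on the degree. A form splits as G + x W with G free of x;
    if its value is a + x b, then x cancels in x (W - b) = a - G by [quasi_regular_power]. Adding x
    times the coefficients of W - b to those of G settles G, and W has lower degree. *)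
Lemma rreg_quasi_regular xs : rreg T xs -> quasi_regular xs.
Proof.
elim: xs => [|x xs IHxs] /=.
  by move=> _ [|k] v //; rewrite /lcomb big_ord1 /= scale1r => v0 [].
case=> xreg /IHxs{IHxs} qr; elim=> [|k IHk] v.
  by rewrite monomials_0 lspan_monomials_1 /lcomb big_ord1 /= scale1r => v0 [].
rewrite monomials_S lcomb_cat lcomb_map size_cat size_map.
set G := lcomb _ v; set W := lcomb _ _; case/lspan_monomials_S=> a [b [Ma Mb eqGW]].
have Mg : lspan (monomials xs k.+1) T (W - b).
  apply: (quasi_regular_power (x := x)) => //.
  have -> : x *: (W - b) = a - G.
    by rewrite scalerBr; apply/eqP; rewrite subr_eq addrAC -eqGW addrAC subrr add0r.
  apply: submB; [exact: subP | exact: lspan_monomials_le |].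
  by apply/lspan_lcomb; exists v.
have Mv i : (i < size (monomials xs k.+1))%N -> lspan (x :: xs) T (v i).
  have /lspan_lcomb[g def_g] := Mg => lti.
  have : lspan xs T (v i + x *: g i).
    apply: (qr k.+1 (fun i => v i + x *: g i)) lti.
    have -> : lcomb (monomials xs k.+1) (fun i => v i + x *: g i) = a; last by [].
    have -> : a = G + x *: (W - b).
      by rewrite scalerBr addrA eqGW addrK.
    rewrite def_g /G /lcomb scaler_sumr -big_split; apply: eq_bigr => l _ /=.
    by rewrite scalerDr !scalerA mulrC.
  by move=> xvg; exists (- g i) => //; exists (v i + x *: g i) => //; rewrite scalerN addrC addrK.
move=> i lti; have [/Mv //|le_i] := ltnP i (size (monomials xs k.+1)).
rewrite -(subnKC le_i); apply: (IHk (fun i => v (size (monomials xs k.+1) + i)%N)).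
  rewrite -/W -(subrK b W); apply: submD => //.
  exact: lspan_monomials_cons.
by rewrite ltn_subLR.
Qed.

Lemma smul_pow_ideal (I : set R) xs k : {in xs, forall a, I a} -> mul_into I xs T ->
  smul (pow_ideal I k) T = lspan (monomials xs k) T.
Proof.
move=> xsI IV; apply/seteqP; split.
  apply: smul_min => // a v; elim: k a v => [|k IHk] a v Ia _.
    by rewrite monomials_0; exact: lspan1.
  suff : pow_ideal I k.+1 `<=` [set a : R^o | lspan (monomials xs k.+1) T (a *: v)] by apply.
  apply: (@smul_min R (R^o : lmodType R) I (pow_ideal I k)).
    apply/submoduleP; split; first by rewrite /= scale0r; exact: (subm0 (subP _)).
    by move=> b c e Mc Me; rewrite /= scalerDl -scalerA; apply: (submL (subP _)).
  move=> b c Ib Ic; rewrite /= -scalerA; have := IHk c v Ic Logic.I; move: (c *: v) => w Mw.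
  apply: lspan_monomials_span; apply: (lspan_linear (f := scale_lin V b) _ Mw) => u _.
  exact: IV.
have MI : {in monomials xs k, forall a, pow_ideal I k a}.
  elim: xs {IV} k xsI => [|x xs IHxs] k xsI; first by case: k.
  elim: k => [|k IHk] a //; rewrite monomials_S mem_cat => /orP[Ma|/mapP[b Mb ->]].
    by apply: IHxs => // c xc; apply: xsI; rewrite inE xc orbT.
  by apply: (@smul_mem R (R^o : lmodType R)); [apply: xsI; rewrite inE eqxx | exact: IHk].
apply: lspan_min => [|a v Ma _]; first by apply: subm_smul.
by apply: smul_mem => //; exact: MI.
Qed.

End Quasi.

End Monomials.

Section Length.
Variable R : comNzRingType.
Implicit Types (V W U : lmodType R).

(** [quotient_length] is the case where T is the whole module; a free upper end lets chains be
    concatenated along the powers of Q. *)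
Definition length_between V (S T : set V) (l : nat) : Prop :=
  exists L : nat -> set V,
  [/\ L 0%N = S, L l = T, forall i, (i <= l)%N -> submodule (L i)
    & forall i, (i < l)%N -> L i `<` L i.+1 /\
        forall P : set V, submodule P -> L i `<=` P -> P `<=` L i.+1 ->
          P = L i \/ P = L i.+1].

Lemma length_refl V (S : set V) : submodule S -> length_between S S 0.
Proof. by move=> subS; exists (fun=> S). Qed.

Lemma length_trans V (S T U : set V) a b :
  length_between S T a -> length_between T U b -> length_between S U (a + b).
Proof.
move=> [L [L0 La subL stepL]] [K [K0 Kb subK stepK]].
pose M i := if (i <= a)%N then L i else K (i - a)%N.
have ML i : (i <= a)%N -> M i = L i by rewrite /M => ->.
have MK i : M (a + i)%N = K i.
  rewrite /M; case: i => [|i]; first by rewrite addn0 leqnn La K0.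
  by rewrite leqNgt addnS ltnS leq_addr /= -addnS addKn.
exists M; split=> [||i lei|i lti].
- by rewrite ML.
- by rewrite MK.
- have [/[dup]/ML ->|/ltnW leai] := leqP i a; first exact: subL.
  by rewrite -(subnKC leai) MK; apply: subK; rewrite leq_subLR.
have [ltia|leai] := ltnP i a; first by rewrite !ML // 1?ltnW //; exact: stepL.
by rewrite -(subnKC leai) -addnS !MK; apply: stepK; rewrite ltn_subLR.
Qed.

Lemma length_sub V (S T : set V) l : length_between S T l -> S `<=` T.
Proof.
case=> L [<- <- _]; elim: l => [|l IHl] stepL //.
apply: (@subset_trans _ (L l)); last by have [[]] := stepL l (ltnSn l).
by apply: IHl => i lti; apply: stepL; exact: ltnW.
Qed.

(** A chain from K to V is pushed forward by f and enlarged by S. An intermediate submodule is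
    recognized by intersecting its preimage with the upper term of the original step. *)
Lemma length_image V W (f : {linear V -> W}) (S : set W) (K : set V) l :
  submodule S -> f @^-1` S = K -> length_between K setT l ->
  length_between S (addS S (range f)) l.
Proof.
move=> subS <- [L [L0 Ll subL stepL]].
have SL i : (i <= l)%N -> f @^-1` S `<=` L i.
  elim: i => [|i IHi] lei; first by rewrite L0.
  by apply: subset_trans (IHi (ltnW lei)) _; have [[]] := stepL i lei.
exists (fun i => addS S (f @` L i)); split=> [||i lei|i lti].
- rewrite L0; apply/seteqP; split; last first.
    by apply: addSl; apply: subm_image; exact: subm_preimage.
  by move=> _ [s Ss [_ [v Sv <-] ->]]; apply: submD.
- by rewrite Ll.
- by apply: subm_add => //; apply: subm_image; exact: subL.
have [[sub_i not_i] cov] := stepL i lti.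
have subLi := subL i (ltnW lti); have subLi1 := subL _ lti.
split; first split.
- move=> _ [s Ss [_ [v Lv <-] ->]]; exists s => //; exists (f v) => //.
  by exists v => //; exact: sub_i.
- move=> le_i; apply: not_i => v Lv.
  have [s Ss [_ [u Lu <-] fv]] : addS S (f @` L i) (f v).
    by apply: le_i; apply: addSr => //; exists v.
  apply: (submBr subLi Lu); apply: (SL i (ltnW lti)).
  by rewrite /preimage /= linearB fv addrK.
move=> P subP leP Ple.
have SP : S `<=` P.
  by apply: subset_trans leP; apply: addSl; exact: subm_image.
have [|||PL|PL] := cov ((f @^-1` P) `&` L i.+1).
- by apply: subm_setI => //; exact: subm_preimage.
- move=> v Lv; split; last exact: sub_i.
  by apply: leP; apply: addSr => //; exists v.
- by move=> v [].
- left; apply/seteqP; split=> // p Pp.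
  have [s Ss [_ [u Lu <-] def_p]] := Ple p Pp.
  exists s => //; exists (f u) => //; exists u => //; rewrite -PL; split=> //.
  rewrite /preimage /=; have -> : f u = p - s by rewrite def_p addrC addKr.
  by apply: submB => //; exact: SP.
right; apply/seteqP; split=> // _ [s Ss [_ [u Lu <-] ->]].
apply: submD => //; first exact: SP.
by have : ((f @^-1` P) `&` L i.+1) u; [rewrite PL | case].
Qed.

Section Family.
Variables (U W : lmodType R) (K : set U) (S : set W) (n : nat) (f : nat -> {linear U -> W}).
Hypothesis subS : submodule S.
Hypothesis fK : forall i v, (i < n)%N -> K v -> S (f i v).
Hypothesis f_indep : forall u : nat -> U, S (\sum_(i < n) f i (u i)) ->
  forall i, (i < n)%N -> K (u i).

Let sums k := [set w | exists u : nat -> U, w = \sum_(i < k) f i (u i)].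

Let subm_sums k : submodule (sums k).
Proof.
apply/submoduleP; split; first by exists (fun=> 0); rewrite big1 // => i _; rewrite linear0.
move=> a _ _ [u ->] [v ->]; exists (fun i => a *: u i + v i).
by rewrite scaler_sumr -big_split; apply: eq_bigr => i _; rewrite linearP.
Qed.

Let step k := addS S (sums k).

Let subm_step k : submodule (step k). Proof. exact: subm_add. Qed.

(** The f_i induce an isomorphism of (U/K)^n with the quotient measured here, and summands are added
    one at a time. It serves both for N/QN as (R/I)^n and for Q^k N/Q^(k+1) N as copies of N/QN. *)
Lemma length_family l : length_between K setT l ->
  length_between S (addS S [set w | exists u : nat -> U, w = \sum_(i < n) f i (u i)]) (n * l).
Proof.
move=> lenK; suff: forall k, (k <= n)%N -> length_between S (step k) (k * l) by apply.
elim=> [|k IHk] lek.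
  rewrite mul0n; have -> : step 0 = S; last exact: length_refl.
  apply/seteqP; split=> [_ [s Ss [_ [u ->] ->]]|s Ss]; first by rewrite big_ord0 addr0.
  by exists s => //; exists 0; rewrite ?addr0 //; exists (fun=> 0); rewrite big_ord0.
rewrite mulSn addnC; apply: length_trans (IHk (ltnW lek)) _.
have -> : step k.+1 = addS (step k) (range (f k)).
  apply/seteqP; split=> [_ [s Ss [_ [u ->] ->]]|_ [_ [s Ss [_ [u ->] ->]] [_ [v _ <-] ->]]].
    exists (s + \sum_(i < k) f i (u i)).
      by exists s => //; eexists; last reflexivity; exists u.
    by exists (f k (u k)); [exists (u k) | rewrite big_ord_recr addrA].
  exists s => //; rewrite -addrA; eexists; last reflexivity.
  exists (fun i => if (i < k)%N then u i else v); rewrite big_ord_recr /= ltnn; congr (_ + _).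
  by apply: eq_bigr => i _; rewrite ltn_ord.
apply: length_image lenK => //; apply/seteqP; split=> v; last first.
  by move=> Kv; apply: addSl; [exact: subm_sums | exact: fK].
case=> s Ss [_ [u ->] def_fv].
(* These arguments cancel the terms before k and put v at k, so the sum is s, which lies in S;
   independence then gives v in K. *)
pose u' i := if (i < k)%N then - u i else if i == k then v else 0.
have <- : u' k = v by rewrite /u' ltnn eqxx.
apply: f_indep => //; have -> : \sum_(i < n) f i (u' i) = s; last by [].
rewrite -(subnKC lek) big_split_ord /= [X in _ + X]big1 ?addr0; last first.
  move=> i _; have ltk : (k < k.+1 + i)%N by rewrite addSn ltnS leq_addr.
  by rewrite /u' ltnNge ltnW //= gtn_eqF // linear0.
rewrite big_ord_recr /= {2}/u' ltnn eqxx def_fv addrC -addrA -big_split big1 ?addr0 //.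
by move=> i _; rewrite /= /u' ltn_ord linearN subrr.
Qed.

End Family.

End Length.

(** * Hilbert functions and the vanishing of e^1 *)

Section Hilbert.
Variables (R : comNzRingType) (m I : set R) (xs : seq R).
Implicit Types (V N : lmodType R).
Hypotheses (noethR : noetherian_ring R) (localR : local_ring m) (I_primary : primary_to m I).
Hypothesis xsI : {in xs, forall a, I a}.
Let idI : ideal I. Proof. exact: primary_to_ideal I_primary. Qed.

(** Take a maximal M among the ideals reached from I by a composition series. If M were proper,
    every element of m would be nilpotent modulo M, and a socle element of R/M would add one more
    simple step. *)
Lemma length_quotient_ring : exists l, length_between (I : set R^o) setT l.
Proof.
have idm := local_ideal localR.
have [M [l lenM] maxM] : exists2 M : set R, (exists l, length_between (I : set R^o) M l) &
    forall J : set R, (exists l, length_between (I : set R^o) J l) -> M `<=` J -> J = M.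
  apply: (@ideal_max R noethR [set M | exists l, length_between (I : set R^o) M l] I).
    by move=> _ [l [L [_ <- subL _]]]; exact: subL.
  by exists 0%N; exact: length_refl.
have idM : ideal M by have [L [_ <- subL _]] := lenM; exact: subL.
have IM : I `<=` M by exact: (length_sub lenM).
have [M1|M1] := pselect (M 1).
  exists l; have <- : M = setT; last exact: lenM.
  apply/seteqP; split=> // a _; rewrite -[a]mulr1; exact: idealM.
have [_ radI] := I_primary.
have [|c Mc cm] := socle_mod noethR idM M1 (m := m).
  by move=> a; rewrite -{1}radI => -[n In]; exists n; exact: IM.
have idMc : ideal (addS (M : set R^o) (range (point_lin (c : R^o)))).
  by apply: subm_add => //; apply: subm_image; exact: submT.
have McM : M `<=` addS (M : set R^o) (range (point_lin (c : R^o))).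
  by apply: (@addSl R (R^o : lmodType R)); apply: subm_image; exact: submT.
exfalso; apply: (Mc).
have <- : addS (M : set R^o) (range (point_lin (c : R^o))) = M; last first.
  by apply: (@addSr R (R^o : lmodType R)) => //; exists 1; rewrite //= scale1r.
apply: maxM => //; exists (l + 1)%N; apply: length_trans lenM _.
exists (fun i => if i is 0 then M else addS (M : set R^o) (range (point_lin (c : R^o)))).
split=> // [[|i] //|[|//] _]; split; first split=> //.
  move=> le_c; apply: Mc; apply: le_c; apply: (@addSr R (R^o : lmodType R)) => //.
  by exists 1; rewrite //= scale1r.
move=> P subP MP PMc.
have [Pc|Pc] := pselect (P c).
  right; apply/seteqP; split=> // _ [a Ma [_ [b _ <-] ->]].
  by apply: (submD subP); [exact: MP | exact: (submZ subP)].
left; apply/seteqP; split=> // p Pp; have [a Ma [_ [b _ <-] def_p]] := PMc p Pp.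
have [mb|/(local_unit noethR localR)[b' bb']] := pselect (m b).
  rewrite def_p; apply: (submD idM) => //=; rewrite [_ *: _]mulrC; exact: cm.
case: Pc; have -> : c = b' * (p - a).
  by rewrite def_p addrAC subrr add0r -[point_lin _ _]/(b * c) mulrA [b' * b]mulrC bb' mul1r.
by apply: (submZ subP); apply: (submB subP) => //; exact: MP.
Qed.

(** The kernel of [rho] lies in I R^n and IN = QN, so N/QN is (R/I)^n. *)
Lemma length_quotient n N (rho : {linear 'rV[R]_n -> N}) :
  range rho = setT -> (forall v, rho v = 0 -> ext _ I v) -> mul_into I xs [set: N] ->
  exists l, length_between (lspan xs [set: N]) setT l.
Proof.
move=> surrho kerrho IN; have [l lenI] := length_quotient_ring.
pose e i : 'rV[R]_n := \row_j (i == j :> nat)%:R.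
exists (n * l)%N.
have subQ : submodule (lspan xs [set: N]) by apply: subm_lspan; exact: submT.
have rhoE (a : nat -> R^o) : \sum_(i < n) point_lin (rho (e i)) (a i) = rho (\row_i a i).
  rewrite [\row_i _]row_sum_delta linear_sum; apply: eq_bigr => i _.
  rewrite /= mxE linearZ; congr (_ *: rho _); apply/rowP=> j.
  by rewrite !mxE eq_sym.
have setTE : addS (lspan xs [set: N])
    [set w | exists a : nat -> R^o, w = \sum_(i < n) point_lin (rho (e i)) (a i)] = setT.
  apply/seteqP; split=> // w _; apply: addSr => //.
  have : range rho w by rewrite surrho.
  case=> v _ <-; pose a k : R^o := if insub k is Some i then v 0 i else 0.
  by exists a; rewrite rhoE; congr (rho _); apply/rowP=> i; rewrite mxE /a valK.
rewrite -[X in length_between _ X _]setTE;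
apply: (length_family (f := fun i => point_lin (rho (e i))) subQ _ _ lenI)
  => [i a _ Ia|a Qa i lti].
  by rewrite /=; exact: IN.
move: Qa; rewrite rhoE -surrho lspan_image => -[q xq eq_q].
have /kerrho/(ext_rV _ idI)/(_ (Ordinal lti)) : rho (\row_i a i - q) = 0.
  by rewrite linearB eq_q subrr.
rewrite !mxE; apply: submBr => //.
by have /(ext_rV _ idI) := lspan_ext xsI idI xq; exact.
Qed.

Lemma length_power_step N l k : rreg [set: N] xs ->
  length_between (lspan xs [set: N]) setT l ->
  length_between (lspan (monomials xs k.+1) [set: N]) (lspan (monomials xs k) [set: N])
    ('C((size xs + k).-1, k) * l).
Proof.
move=> reg lenN; rewrite -size_monomials.
have subP s : submodule (lspan s [set: N]) by apply: subm_lspan; exact: submT.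
have -> : lspan (monomials xs k) [set: N] = addS (lspan (monomials xs k.+1) [set: N])
    [set w | exists u : nat -> N,
      w = \sum_(i < size (monomials xs k)) scale_lin N (monomials xs k)`_i (u i)].
  apply/seteqP; split=> [w /lspan_lcomb[c ->]|_ [s Ms [_ [u ->] ->]]].
    by apply: addSr => //; exists c.
  apply: submD => //; first exact: lspan_monomials_le.
  by apply/lspan_lcomb; exists u.
apply: (length_family (f := fun i => scale_lin N (monomials xs k)`_i) (subP _) _ _ lenN)
  => [i v lti xv|u Mu i lti].
  apply: lspan_monomials_span; apply: lspan_mem => //; exact: mem_nth.
exact: (rreg_quasi_regular reg Mu).
Qed.

(** The layers add up by Pascal's rule. With d = [size xs], the induction starts at the binomial
    coefficient of d - 1 over d, which is 0 because d > 0. *)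
Lemma length_power N l k : (0 < size xs)%N -> rreg [set: N] xs ->
  length_between (lspan xs [set: N]) setT l ->
  length_between (lspan (monomials xs k) [set: N]) setT ('C((size xs + k).-1, size xs) * l).
Proof.
move=> xs_gt0 reg lenN; elim: k => [|k IHk].
  rewrite addn0 bin_small ?prednK // mul0n monomials_0.
  have -> : lspan [:: 1] [set: N] = setT by apply/seteqP; split=> // v _; exact: lspan1.
  by apply: length_refl; exact: submT.
have := length_trans (length_power_step k reg lenN) IHk; rewrite -mulnDl addnC addnS.
case: (size xs) xs_gt0 => // d _; rewrite !addSn /= binS.
by rewrite -[in X in _ -> X](bin_sub (leq_addr k d)) addKn.
Qed.

Lemma module_dim_faithful N d : krull_dim R d ->
  (forall a, (forall v : N, a *: v = 0) -> a = 0) -> module_dim N d.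
Proof.
move=> dimR faithN; rewrite /module_dim.
have -> : annihilator N = [set 0]; last exact: dimR.
by apply/seteqP; split=> [a /faithN //|a /= -> v]; rewrite scale0r.
Qed.

Lemma hilbert_e1_zero n N (rho : {linear 'rV[R]_n -> N}) : krull_dim R (size xs) ->
  (0 < size xs)%N -> range rho = setT -> (forall v, rho v = 0 -> ext _ I v) ->
  rreg [set: N] xs -> mul_into I xs [set: N] ->
  (forall a, (forall v : N, a *: v = 0) -> a = 0) -> hilbert_coefficient I N 1 0.
Proof.
move=> dimR xs_gt0 surrho kerrho reg IN faithN.
have [l lenN] := length_quotient surrho kerrho IN.
(* Here e^0 is the length of N/QN and the other coefficients are 0; the formula holds from k = 0
   on. *)
exists (size xs), (fun j => if j is 0 then l%:Z else 0); split=> //.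
  exact: module_dim_faithful.
exists 0%N => k _; exists ('C((size xs + k).-1, size xs) * l)%N.
  rewrite (smul_pow_ideal k xsI IN); exact: length_power.
rewrite big_ord_recl big1 ?addr0 => [|j _]; last by rewrite mulr0 mul0r.
by rewrite expr0 mul1r !subn0 subn1 [(k + _)%N]addnC PoszM mulrC.
Qed.

End Hilbert.

(** * Assembly of the theorem *)

Lemma rreg_nonzerodivisor (R : comNzRingType) (V : lmodType R) (xs : seq R) :
  rreg [set: V] xs -> (0 < size xs)%N ->
  exists2 a, a \in xs & forall v : V, a *: v = 0 -> v = 0.
Proof.
elim: xs => // x [|x' xs] IHxs [xreg reg] _.
  by exists x => [|v xv0]; [rewrite inE | apply: (xreg v)].
by have [//|//|a xa areg] := IHxs _ _; exists a; rewrite // inE xa orbT.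
Qed.

(** The transpose comes with its own presentation of N; the self-cover obtained from the cone has to
    be moved onto it. *)
Lemma self_cover_transport (R : comNzRingType) (I : set R) r n n' (N : lmodType R)
    (p : {linear 'rV[R]_n -> N}) (p' : {linear 'rV[R]_n' -> N})
    (nu : {linear {ffun 'I_r -> N} -> 'rV[R]_n}) (f : {linear 'rV[R]_n -> 'rV[R]_n'}) :
  bijective f -> (forall v, p' (f v) = p v) -> self_cover I p nu ->
  self_cover I p' (f \o nu : {linear {ffun 'I_r -> N} -> 'rV[R]_n'}).
Proof.
move=> bijf p'f [surp injnu kerp nuI]; have [g fK gK] := bijf.
split=> [||v|w].
- apply/seteqP; split=> // l _; have : range p l by rewrite surp.
  by case=> v _ <-; exists (f v).
- exact: inj_comp (bij_inj bijf) injnu.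
- rewrite -[v]gK p'f; split=> [/kerp[w <-]|[w /= /(bij_inj bijf) ew]]; first by exists w.
  by apply/kerp; exists w.
exact: (ext_linear f (nuI w)).
Qed.

Theorem corollary5p10 (R : comNzRingType) (m : set R) (d : nat)
    (I : set R) (x : d.-tuple R) (MI : lmodType R)
    (noethR : noetherian_ring R) (localR : local_ring m)
    (CM_R : cohen_macaulay m)
    (infinite_residue : infinite_set (residue_classes m))
    (dimR : krull_dim R d) (d_ge1 : (1 <= d)%N)
    (I_primary : primary_to m I)
    (sop_x : system_of_parameters m x)
    (red_x : reduction (ideal_gen x) I)
    (ulrichI : ulrich_ideal (ideal_gen x) I)
    (not_param : ~ parameter_ideal m I)
    (* MI is the ideal I viewed as an R-module *)
    (MI_I : iso_submodule MI (I : set R^o)) :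
  (forall (k : nat) (N : lmodType R), (d - 1 <= k)%N ->
     is_iter_syzygy m k MI N -> hilbert_coefficient I N 1%N 0%R) /\
  (gorenstein_ring R ->
   forall (k : nat) (N L : lmodType R), (d <= k)%N ->
     is_iter_syzygy m k MI N -> is_lambda m N L ->
     hilbert_coefficient I L 1%N 0%R).
Proof.
have xE (V : lmodType R) : lspan (rev x) [set: V] = lspan x [set: V].
  by apply/seteqP; split; apply: (lspan_subseq (@submT R V)) => a; rewrite mem_rev.
(* [rreg] reads a list from its end, so the reversed list keeps the order x_1, ..., x_d. *)
set xs := rev x in xE.
have size_xs : size xs = d by rewrite size_rev size_tuple.
have idI := primary_to_ideal I_primary.
have [[[idm _] _] _] := localR.
have Im : I `<=` m by case: I_primary => _ <- a Ia; exists 1%N.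
have QE : ideal_gen x = lspan xs [set: R^o] by rewrite ideal_genE xE.
have xsI : {in xs, forall a, I a}.
  move=> a xa; case: red_x => QI _; apply: QI; rewrite QE -[a]mulr1.
  by apply: (@lspan_mem R (R^o : lmodType R)) => //; exact: submT.
(* [cohen_macaulay] carries its own dimension, which is identified with d by comparing chains of
   primes. *)
have [ys [size_ys ym [y_reg _]]] : exists ys,
    [/\ size ys = d, forall a, a \in ys -> m a & regular_sequence ys].
  have [d' [[P chainP] max_d'] [[ys [size_ys ym y_reg]] _]] := CM_R.
  exists ys; split=> //; rewrite size_ys; have [[P' chainP'] max_d] := dimR.
  by apply/eqP; rewrite eqn_leq (max_d _ _ chainP) (max_d' _ _ chainP').
have exactK : forall k (z : koszul xs k.+1), koszul_d z = 0 -> exists w, koszul_d w = z.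
  move=> k; apply: (@koszul_exact R xs ys); first by rewrite size_xs size_ys.
    by move=> t a lt_t; rewrite -ideal_genE; exact: y_reg.
  move=> y /ym; have [_ [_ <-]] := sop_x; case=> n; rewrite QE => xn.
  by exists n.
have reg : rreg [set: R^o] xs.
  by apply: (rreg_of_exact noethR localR) => [a /xsI /Im //|]; exact: exactK.
have [eqII freeI] := ulrichI.
have IIx : pow_ideal I 2 `<=` lspan xs (I : set R^o).
  rewrite eqII; apply: (@smul_min R (R^o : lmodType R)); first exact: subm_lspan.
  move=> a v; rewrite QE => xa Iv.
  apply: (lspan_linear (f := point_lin (v : R^o)) _ xa) => b _ /=.
  exact: (submZ idI).
have sqI a b : I a -> I b -> lspan xs (I : set R^o) (a * b).
  by move=> Ia Ib; apply: IIx; exact: mem_pow2.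
have xs_indep := rreg_independent idI xsI reg.
have [zs [zsI genI zs_indep]] := conormal_complement noethR localR I_primary freeI xsI reg IIx.
(* If nothing had to be added to x, then I would equal Q, a parameter ideal. *)
have zs_gt0 : (0 < size zs)%N.
  case: zs genI {zsI zs_indep} => // genI; case: not_param; exists x => //.
  rewrite QE; apply/seteqP; split=> // a; rewrite -QE; exact: (proj1 red_x).
have xs_gt0 : (0 < size xs)%N by rewrite size_xs.
have faithI a : (forall b, I b -> a * b = 0) -> a = 0.
  have [b /xsI Ib breg] := rreg_nonzerodivisor reg xs_gt0.
  by move/(_ b Ib) => ab0; apply: breg; rewrite -[_ *: _]/(b * a) mulrC.
have dim_xs : krull_dim R (size xs) by rewrite size_xs.
have cover k N : (d - 1 <= k)%N -> is_iter_syzygy m k MI N ->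
    (forall a, (forall v : N, a *: v = 0) -> a = 0) /\
    exists n (pi : {linear 'rV[R]_n -> N}) (nu : {linear {ffun 'I_(size zs) -> N} -> 'rV[R]_n}),
      self_cover I pi nu.
  move=> lek syzN.
  have [A [phi [j [q [coneA [f injf rangef]]]]]] := cone_syzygy noethR localR idI Im xsI
    zsI exactK xs_indep sqI genI zs_indep zs_gt0 faithI MI_I syzN.
  apply: (cone_self_cover _ _ _ _ _ _ coneA injf rangef) => //.
  by rewrite size_xs -add1n -leq_subLR.
split=> [k N lek syzN|gorR k N L lek syzN [T [n1 [n0 [A [pi [minA [rho surrho kerrho]]]]]]]].
  have [faithN [n [pi [nu coverN]]]] := cover k N lek syzN.
  have [surpi _ kerpi nuI] := coverN.
  apply: (hilbert_e1_zero noethR localR I_primary xsI dim_xs xs_gt0 surpi) => //.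
  - by move=> v /kerpi[w <-].
  - exact: (self_cover_rreg zs_gt0 coverN reg).
  exact: (self_cover_mul_into zs_gt0 coverN reg sqI).
case=> n2 [n3 [A' [pi' [[surpi' kerpi' minpi' _] [e inje rangee]]]]].
have [|faithN [n [p [nu coverN]]]] := cover k N _ syzN; first by rewrite (leq_trans (leq_subr _ _)).
have [surpi kerpi minpi _] := minA; have [surp _ kerp nuI] := coverN.
have [||f bijf pif] := cover_unique noethR localR (ffree_rV R n) (ffree_rV R n0) surp surpi.
- by move=> v /kerp[w <-]; apply: smulS (nuI w).
- by move=> v /minpi mv; apply/(ext_rV _ idm).
have coverpi := self_cover_transport bijf pif coverN.
have Am i l : m (A i l).
  have := minpi (row i A) _ l; rewrite mxE; apply; apply/kerpi.
  by exists (delta_mx 0 i); rewrite -rowE.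
(* As A has entries in m, [rho] is a minimal cover of Tr N. The syzygy L, taken from another minimal
   presentation, is thus carried by g onto the image of A^T. *)
have [||g bijg rhog] := cover_unique noethR localR (ffree_rV R n3) (ffree_rV R n1) surpi' surrho.
- by move=> v /minpi' mv; apply/(ext_rV _ idm).
- move=> v /kerrho[u ->]; apply/(ext_rV _ idm) => l; rewrite mxE.
  by apply: (subm_sum idm) => i _; rewrite mxE; apply: (idealM _ idm).
have [g' gK g'K] := bijg.
have inj_ge : injective (g \o e) by exact: inj_comp (bij_inj bijg) inje.
have range_ge : range (g \o e) = range (fun v : 'rV[R]_n0 => v *m A^T).
  apply/seteqP; split=> [_ [l _ <-]|_ [v _ <-]].
    have : range (fun u : 'rV[R]_n2 => u *m A') (e l) by rewrite -rangee; exists l.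
    case=> u _ eu; have : rho (g (e l)) = 0 by rewrite rhog; apply/kerpi'; exists u.
    by case/kerrho=> v ev; exists v.
  have : pi' (g' (v *m A^T)) = 0 by rewrite -rhog g'K; apply/kerrho; exists v.
  case/kerpi'=> u eu; have : range (fun u : 'rV[R]_n2 => u *m A') (g' (v *m A^T)) by exists u.
  by rewrite -rangee => -[l _ el]; exists l; rewrite //= el g'K.
have [regL IL faithL [q surq kerq]] :=
  dual_good idI zs_gt0 coverpi kerpi inj_ge range_ge gorR reg sqI faithN.
exact: (hilbert_e1_zero noethR localR I_primary xsI dim_xs xs_gt0 surq kerq regL IL faithL).
Qed.
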